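(* The spaces $AHHol_5^{LF}(\mathbb{C}P^3)$, $AHarm_5^{+}(S^4)$ and $AHarm_5^{-}(S^4)$ are path-connected.
   Context: Identify $S^2=\mathbb{C}P^1=\mathbb{C}\cup\{\infty\}$ with coordinate $z$, so that the antipodal map is $z\mapsto-1/\bar z$. The twistor fibration $\pi:\mathbb{C}P^3\to S^4\subset\mathbb{C}^2\oplus\mathbb{R}=\mathbb{R}^5$ is $$\pi([z_1,z_2,z_3,z_4])=\frac{\left(2(\bar z_1z_3+z_2\bar z_4),\,2(\bar z_1z_4-z_2\bar z_3),\,|z_1|^2+|z_2|^2-|z_3|^2-|z_4|^2\right)}{|z_1|^2+|z_2|^2+|z_3|^2+|z_4|^2}.$$ A holomorphic curve $\psi=[f_1,f_2,f_3,f_4]:S^2\to\mathbb{C}P^3$ is horizontal if it is tangent to the orthogonal complement (for the Fubini-Study metric) of the fibers of $\pi$; equivalently $f_1'f_2-f_1f_2'+f_3'f_4-f_3f_4'=0$. It is linearly full if its image lies in no projective hyperplane. A holomorphic curve of degree $d$ is written $[f_1,f_2,f_3,f_4]$ with $f_i$ polynomials without common zeros and maximal degree $d$. $HHol_d^{LF}(\mathbb{C}P^3)$ is the set of linearly full horizontal holomorphic curves $S^2\to\mathbb{C}P^3$ of degree $d$, with the topology induced from $P((\mathbb{C}[z]_d)^4)$, where $\mathbb{C}[z]_d$ is the vector space of polynomials of degree at most $d$. $AHHol_d^{LF}(\mathbb{C}P^3)\subset HHol_d^{LF}(\mathbb{C}P^3)$ is the subspace of those $\psi$ for which $\pi\circ\psi$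 is invariant under the antipodal map of $S^2$. $Harm_d^{LF}(S^4)$ is the set of linearly full (image not in a hyperplane of $\mathbb{R}^5$ through the origin) harmonic maps $S^2\to S^4$ with induced area $4\pi d$, with the compact-open topology. It is the disjoint union of $Harm_d^{\pm}(S^4)=\{\pm\pi\circ\psi:\psi\in HHol_d^{LF}(\mathbb{C}P^3)\}$. $AHarm_d^{\pm}(S^4)\subset Harm_d^{\pm}(S^4)$ is the subspace of maps invariant under the antipodal map of $S^2$ (i.e. factoring through $\mathbb{R}P^2$). *)

(* Defs.v *)
From HB Require Import structures.
From mathcomp Require Import all_boot all_order all_algebra generic_quotient.
From mathcomp Require Import all_classical all_reals all_analysis.
From mathcomp.real_closed Require Import complex.
From mathcomp Require Import ring lra zify.

Set Implicit Arguments.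
Unset Strict Implicit.
Unset Printing Implicit Defensive.

Import Order.TTheory GRing.Theory Num.Theory.
Import numFieldNormedType.Exports.

Local Open Scope classical_set_scope.
Local Open Scope ring_scope.
Local Open Scope quotient_scope.

(* [0, 1] is taken in the parameter R; nonemptiness is part of the notion. *)
Definition path_connected (R : realType) (T : topologicalType) : Prop :=
  inhabited T /\
  forall x y : T, exists g : R -> T,
    [/\ {within `[0, 1], continuous g}, g 0 = x & g 1 = y].

Section Projective.
Variables (K : numFieldType) (m n : nat).

Definition nonzero : set 'M[K]_(m, n) := [set v | v != 0].

Definition proportional (v w : nonzero) : bool :=
  `[< exists2 c : K, c != 0 & val v = c *: val w >].

Lemma proportional_refl : reflexive proportional.
Proof. by move=> v; apply/asboolP; exists 1; rewrite ?oner_neq0 ?scale1r. Qed.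

Lemma proportional_sym : symmetric proportional.
Proof.
have H v w : proportional v w -> proportional w v.
  move=> /asboolP[c c0 e]; apply/asboolP; exists c^-1; rewrite ?invr_eq0//.
  by rewrite e scalerA mulVf ?scale1r.
by move=> v w; apply/idP/idP; exact: H.
Qed.

Lemma proportional_trans : transitive proportional.
Proof.
move=> u v w /asboolP[c c0 e] /asboolP[b b0 e']; apply/asboolP.
by exists (c * b); rewrite ?mulf_neq0// e e' scalerA.
Qed.

Canonical proportional_equiv :=
  EquivRel proportional proportional_refl proportional_sym proportional_trans.

(* P(K^(m x n)) with the quotient topology of K^(m x n) \ {0} *)
Definition projective := quotient_topology {eq_quot proportional}.

Definition pclass (v : nonzero) : projective := \pi v.

Definition hcoord (p : projective) : 'M[K]_(m, n) := val (repr p).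

Lemma hcoord_neq0 p : hcoord p != 0.
Proof. exact: (set_valP (repr p)). Qed.

Lemma hcoord_pclass v :
  exists2 c : K, c != 0 & hcoord (pclass v) = c *: val v.
Proof.
apply/asboolP; change (proportional (repr (pclass v)) v).
by apply/eqmodP; rewrite reprK.
Qed.

End Projective.

Section Twistor.
Variable R : realType.

(* Naming the numClosedFieldType gives the carrier R[i] its norm topology. *)
Definition cplx : numClosedFieldType := R[i].
Local Notation C := cplx.

Definition S2 := one_point_compactification C.

Definition antipode (x : S2) : S2 :=
  match x with
  | None => Some 0
  | Some z => if z == 0 then None else Some (- (z^*)^-1)
  end.

Definition CP3 := projective C 1 4.

Definition S4 : set 'rV[R]_5 := [set x | \sum_i x 0 i ^+ 2 = 1].

Definition cre (z : C) : R := complex.Re z.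
Definition cim (z : C) : R := complex.Im z.

Definition sqmod (z : C) : R := cre (`|z| ^+ 2).

Definition hnorm2 (v : 'rV[C]_4) : R :=
  sqmod (v 0 0) + sqmod (v 0 1) + sqmod (v 0 2) + sqmod (v 0 3).

(* C^2 + R is identified with R^5 by real and imaginary parts *)
Definition htwistor_num (v : 'rV[C]_4) : 'rV[R]_5 :=
  let z1 := v 0 0 in let z2 := v 0 1 in let z3 := v 0 2 in let z4 := v 0 3 in
  let a := 2 * (z1^* * z3 + z2 * z4^*) in
  let b := 2 * (z1^* * z4 - z2 * z3^*) in
  let c := sqmod z1 + sqmod z2 - sqmod z3 - sqmod z4 in
  \row_i [:: cre a; cim a; cre b; cim b; c]`_i.

Definition htwistor (v : 'rV[C]_4) : 'rV[R]_5 :=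
  (hnorm2 v)^-1 *: htwistor_num v.

Lemma creD (z w : C) : cre (z + w) = cre z + cre w.
Proof. by case: z w => [? ?] [? ?]. Qed.
Lemma cimD (z w : C) : cim (z + w) = cim z + cim w.
Proof. by case: z w => [? ?] [? ?]. Qed.
Lemma creN (z : C) : cre (- z) = - cre z. Proof. by case: z. Qed.
Lemma cimN (z : C) : cim (- z) = - cim z. Proof. by case: z. Qed.
Lemma creM (z w : C) : cre (z * w) = cre z * cre w - cim z * cim w.
Proof. by case: z w => [? ?] [? ?]. Qed.
Lemma cimM (z w : C) : cim (z * w) = cre z * cim w + cim z * cre w.
Proof. by case: z w => [? ?] [? ?]. Qed.
Lemma creJ (z : C) : cre (z^*) = cre z. Proof. by case: z. Qed.
Lemma cimJ (z : C) : cim (z^*) = - cim z. Proof. by case: z. Qed.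
Lemma cre2 (z : C) : cre (2 * z) = 2 * cre z.
Proof. by rewrite mulr_natl mulr2n creD mulr_natl mulr2n. Qed.
Lemma cim2 (z : C) : cim (2 * z) = 2 * cim z.
Proof. by rewrite mulr_natl mulr2n cimD mulr_natl mulr2n. Qed.
Lemma crer (t : R) : cre (t%:C%C) = t. Proof. by []. Qed.
Lemma cimr (t : R) : cim (t%:C%C) = 0. Proof. by []. Qed.

Lemma cplx_eq (z w : C) : cre z = cre w -> cim z = cim w -> z = w.
Proof. by case: z w => [? ?] [? ?] /= -> ->. Qed.

Lemma sqmodE (z : C) : sqmod z = cre z ^+ 2 + cim z ^+ 2.
Proof. by rewrite /sqmod -[X in cre X](@add_Re2_Im2 R z). Qed.

Lemma sqmod_ge0 (z : C) : 0 <= sqmod z.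
Proof. by rewrite sqmodE addr_ge0 ?sqr_ge0. Qed.

Lemma sqmod_eq0 (z : C) : (sqmod z == 0) = (z == 0).
Proof.
by rewrite sqmodE paddr_eq0 ?sqr_ge0// !sqrf_eq0 [RHS]eq_complex.
Qed.

Definition cplxE := (cre2, cim2, creD, cimD, creN, cimN, creM, cimM, creJ,
  cimJ, crer, cimr, sqmodE).
End Twistor.
Arguments S4 : clear implicits.

Section TwistorFibration.
Variable R : realType.
Local Notation C := (cplx R).
Implicit Types v w p : 'rV[C]_4.

Lemma hnorm2_gt0 v : v != 0 -> 0 < hnorm2 v.
Proof.
have P0 := sqmod_ge0 (v 0 0); have P1 := sqmod_ge0 (v 0 1).
have P2 := sqmod_ge0 (v 0 2); have P3 := sqmod_ge0 (v 0 3).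
apply: contraNT; rewrite -leNgt /hnorm2 => le0.
have e0 : v 0 0 = 0 by apply/eqP; rewrite -sqmod_eq0; apply/eqP; lra.
have e1 : v 0 1 = 0 by apply/eqP; rewrite -sqmod_eq0; apply/eqP; lra.
have e2 : v 0 2 = 0 by apply/eqP; rewrite -sqmod_eq0; apply/eqP; lra.
have e3 : v 0 3 = 0 by apply/eqP; rewrite -sqmod_eq0; apply/eqP; lra.
apply/eqP/rowP => i; rewrite mxE.
by case: i => -[|[|[|[|//]]]] ilt; [rewrite -[RHS]e0|rewrite -[RHS]e1
  |rewrite -[RHS]e2|rewrite -[RHS]e3]; congr (v _ _); apply: val_inj.
Qed.

Lemma htwistor_S4 v : v != 0 -> htwistor v \in S4 R.
Proof.
move=> v0; apply/mem_set => /=.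
have N0 := hnorm2_gt0 v0.
rewrite /S4 /= !big_ord_recl big_ord0 /htwistor /htwistor_num /= !mxE /=.
move: N0; rewrite /hnorm2 !cplxE.
move: (cre _) (cre _) (cre _) (cre _) (cim _) (cim _) (cim _) (cim _) => a b c d e f g h N0.
field.
by rewrite gt_eqF.
Qed.

Lemma htwistorZ (c : C) v : c != 0 -> htwistor (c *: v) = htwistor v.
Proof.
move=> c0; have [->|v0] := eqVneq v 0; first by rewrite scaler0.
apply/rowP => i; rewrite /htwistor /htwistor_num /hnorm2 !mxE.
have N0 := sqmod_eq0 c; move: N0; rewrite (negbTE c0) !cplxE => /negbT N0.
have := lt0r_neq0 (hnorm2_gt0 v0); rewrite /hnorm2 !cplxE => M0.
case: i => -[|[|[|[|[|//]]]]] ilt /=; rewrite ?cplxE ; 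
move: N0 M0; set a1 := cre (v 0 0); set b1 := cim (v 0 0);
 set a2 := cre (v 0 1); set b2 := cim (v 0 1);
 set a3 := cre (v 0 2); set b3 := cim (v 0 2);
 set a4 := cre (v 0 3); set b4 := cim (v 0 3);
 set a := cre c; set b := cim c;
 clearbody a1 b1 a2 b2 a3 b3 a4 b4 a b => N0 M0; field;
 rewrite M0 /=; move: (mulf_neq0 N0 M0); apply: contra_neq => e0;
 rewrite -[RHS]e0; ring.
Qed.

Definition twistor (p : CP3 R) : S4 R :=
  exist _ (htwistor (hcoord p)) (htwistor_S4 (hcoord_neq0 p)).

Lemma twistor_pclass (v : @nonzero C 1 4) : val (twistor (pclass v)) = htwistor (val v).
Proof. by have [c c0 e] := hcoord_pclass v; rewrite /= e htwistorZ. Qed.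

Definition hdot v w : C := \sum_i v 0 i * (w 0 i)^*.

(* p : homogeneous coordinates of a point; v, w : lifts to C^4 of tangent
   vectors at [p], only their parts orthogonal to p matter. *)
Definition fubini_study p v w : R :=
  cre (hdot v w * hdot p p - hdot v p * hdot p w) / hnorm2 p ^+ 2.

(* the tangent vector of CP^3 at [p] lifted by w is killed by d pi *)
Definition vertical p w : Prop :=
  is_derive (0 : R) 1 (fun t : R => htwistor (p + (t%:C)%C *: w)) 0.

Definition horizontal_at p v : Prop :=
  forall w, vertical p w -> fubini_study p v w = 0.

Section Curves.
Variable d : nat.
Implicit Types f : 'M[C]_(4, d.+1).

(* (C[z]_d)^4 is 'M[C]_(4, d.+1): row i lists the coefficients of f_i. *)
Definition hpoly f (i : 'I_4) : {poly C} := rVpoly (row i f).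
Definition hlift f (z : C) : 'rV[C]_4 := \row_i (hpoly f i).[z].
Definition hdlift f (z : C) : 'rV[C]_4 := \row_i ((hpoly f i)^`()).[z].
(* flip f are the coefficients of w^d f(1/w), the lift in the chart w = 1/z. *)
Definition flip f : 'M[C]_(4, d.+1) := \matrix_(i, j) f i (rev_ord j).

Definition heval f (x : S2 R) : 'rV[C]_4 :=
  if x is Some z then hlift f z else hlift (flip f) 0.

Definition holomorphic_coords f : Prop :=
  (forall z : C, exists i, ~~ root (hpoly f i) z) /\
  \max_(i < 4) (size (hpoly f i)).-1 = d.

(* The real tangent plane of the image at z is spanned by the c f'(z). *)
Definition horizontal f : Prop :=
  (forall z c, horizontal_at (hlift f z) (c *: hdlift f z)) /\
  (forall c, horizontal_at (hlift (flip f) 0) (c *: hdlift (flip f) 0)).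
End Curves.

Lemma CP3_base_subproof : (const_mx 1 : 'rV[C]_4) \in @nonzero C 1 4.
Proof.
by apply/mem_set/eqP => /rowP/(_ 0)/eqP; rewrite !mxE oner_eq0.
Qed.

Definition CP3_base : @nonzero C 1 4 :=
  exist (fun v => v \in @nonzero C 1 4) _ CP3_base_subproof.
(* CP3_base is a default value for v = 0; by heval_neq0 it is never reached
   by a curve satisfying holomorphic_coords. *)
Definition CP3_of v : CP3 R := pclass (insubd CP3_base v).

Section Spaces.
Variable d : nat.

Definition curve (psi : projective C 4 d.+1) (x : S2 R) : CP3 R :=
  CP3_of (heval (hcoord psi) x).

Definition linearly_full (phi : S2 R -> CP3 R) : Prop :=
  forall a : 'cV[C]_4, a != 0 -> exists x, hcoord (phi x) *m a != 0.

Definition HHol : set (projective C 4 d.+1) :=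
  [set psi | exists f : @nonzero C 4 d.+1,
    [/\ psi = pclass f, holomorphic_coords (val f), horizontal (val f)
      & linearly_full (curve psi)]].

Definition AHHol : set (projective C 4 d.+1) :=
  [set psi | HHol psi /\
    forall x, twistor (curve psi (antipode x)) = twistor (curve psi x)].

Lemma S4_opp_subproof (x : S4 R) : - val x \in S4 R.
Proof.
apply/mem_set; rewrite /S4 /= -[RHS](set_valP x); apply: eq_bigr => i _.
by rewrite mxE sqrrN.
Qed.
Definition S4_opp (x : S4 R) : S4 R :=
  exist (fun y => y \in S4 R) (- val x) (S4_opp_subproof x).

(* Subspaces of the compact-open topology; only continuous maps occur. *)
Definition Harm_plus : set {compact-open, S2 R -> S4 R} :=
  [set phi | exists2 psi, HHol psi & phi = (fun x => twistor (curve psi x))].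

Definition Harm_minus : set {compact-open, S2 R -> S4 R} :=
  [set phi | exists2 psi, HHol psi &
    phi = (fun x => S4_opp (twistor (curve psi x)))].

Definition AHarm_plus := Harm_plus `&` [set phi : {compact-open, S2 R -> S4 R} |
    forall x, phi (antipode x) = phi x].

Definition AHarm_minus := Harm_minus `&` [set phi : {compact-open, S2 R -> S4 R} |
    forall x, phi (antipode x) = phi x].
End Spaces.
End TwistorFibration.
Arguments HHol : clear implicits.
Arguments AHHol : clear implicits.
Arguments Harm_plus : clear implicits.
Arguments Harm_minus : clear implicits.
Arguments AHarm_plus : clear implicits.
Arguments AHarm_minus : clear implicits.

Section Criteria.
Variable R : realType.
Local Notation C := (cplx R).
Implicit Types v w p : 'rV[C]_4.

Local Notation hopf := (@htwistor_num R).
Lemma hopfE v i : hopf v 0 i =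
  [:: 2 * (cre (v 0 0) * cre (v 0 2) + cim (v 0 0) * cim (v 0 2)
         + (cre (v 0 1) * cre (v 0 3) + cim (v 0 1) * cim (v 0 3)));
      2 * (cre (v 0 0) * cim (v 0 2) - cim (v 0 0) * cre (v 0 2)
         + (cim (v 0 1) * cre (v 0 3) - cre (v 0 1) * cim (v 0 3)));
      2 * (cre (v 0 0) * cre (v 0 3) + cim (v 0 0) * cim (v 0 3)
         - (cre (v 0 1) * cre (v 0 2) + cim (v 0 1) * cim (v 0 2)));
      2 * (cre (v 0 0) * cim (v 0 3) - cim (v 0 0) * cre (v 0 3)
         - (cim (v 0 1) * cre (v 0 2) - cre (v 0 1) * cim (v 0 2)));
      cre (v 0 0) ^+ 2 + cim (v 0 0) ^+ 2 + (cre (v 0 1) ^+ 2 + cim (v 0 1) ^+ 2)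
      - (cre (v 0 2) ^+ 2 + cim (v 0 2) ^+ 2) - (cre (v 0 3) ^+ 2 + cim (v 0 3) ^+ 2)]`_i.
Proof.
rewrite mxE.
by case: i => -[|[|[|[|[|//]]]]] ilt /=; rewrite ?cplxE; ring.
Qed.

Lemma hopf_norm v : htwistor v = (hnorm2 v)^-1 *: hopf v. Proof. by []. Qed.


Definition qpol p w := hopf (p + w) - hopf p - hopf w.
Definition npol p w := hnorm2 (p + w) - hnorm2 p - hnorm2 w.
Definition omega p v : C :=
  v 0 0 * p 0 1 - p 0 0 * v 0 1 + v 0 2 * p 0 3 - p 0 2 * v 0 3.

Lemma qpolE p w i : qpol p w 0 i = hopf (p + w) 0 i - hopf p 0 i - hopf w 0 i.
Proof. by rewrite /qpol; move: (hopf _) (hopf p) (hopf w) => a b c; rewrite !mxE. Qed.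

Lemma addE p w (t : R) i : (p + t%:C%C *: w) 0 i = p 0 i + t%:C%C * w 0 i.
Proof. by rewrite [LHS]mxE [X in _ + X]mxE. Qed.

Lemma addE1 p w i : (p + w) 0 i = p 0 i + w 0 i.
Proof. by rewrite [LHS]mxE. Qed.

Local Ltac gen_coords p :=
  move: (cre (p 0 0)) (cre (p 0 1)) (cre (p 0 2)) (cre (p 0 3))
        (cim (p 0 0)) (cim (p 0 1)) (cim (p 0 2)) (cim (p 0 3)).

Lemma hopf_line p w (t : R) i : hopf (p + t%:C%C *: w) 0 i =
  hopf p 0 i + t * qpol p w 0 i + t ^+ 2 * hopf w 0 i.
Proof.
rewrite qpolE !hopfE !addE !addE1 !cplxE.
gen_coords p; gen_coords w => *.
by case: i => -[|[|[|[|[|//]]]]] ilt /=; ring.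
Qed.

Lemma hnorm2_line p w (t : R) : hnorm2 (p + t%:C%C *: w) =
  hnorm2 p + t * npol p w + t ^+ 2 * hnorm2 w.
Proof.
rewrite /npol /hnorm2 !addE !addE1 !cplxE.
gen_coords p; gen_coords w => *; ring.
Qed.

Lemma hopf_sq p v : \sum_i qpol p v 0 i * hopf p 0 i = hnorm2 p * npol p v.
Proof.
rewrite !big_ord_recl big_ord0 !qpolE !hopfE /= /npol /hnorm2 !addE1 !cplxE.
gen_coords p; gen_coords v => *; ring.
Qed.

Lemma hdotE v w : hdot v w =
 v 0 0 * (w 0 0)^* + v 0 1 * (w 0 1)^* + v 0 2 * (w 0 2)^* + v 0 3 * (w 0 3)^*.
Proof.
rewrite /hdot !big_ord_recl big_ord0 addr0 !addrA.
by do !congr (_ + _); congr (v 0 _ * (w 0 _)^*); apply: val_inj.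
Qed.

Lemma qpolR v w i : qpol v w 0 i =
  [:: 2 * (cre (v 0 0) * cre (w 0 2) + cre (w 0 0) * cre (v 0 2)
         + (cim (v 0 0) * cim (w 0 2) + cim (w 0 0) * cim (v 0 2))
         + (cre (v 0 1) * cre (w 0 3) + cre (w 0 1) * cre (v 0 3))
         + (cim (v 0 1) * cim (w 0 3) + cim (w 0 1) * cim (v 0 3)));
      2 * (cre (v 0 0) * cim (w 0 2) + cre (w 0 0) * cim (v 0 2)
         - (cim (v 0 0) * cre (w 0 2) + cim (w 0 0) * cre (v 0 2))
         + (cim (v 0 1) * cre (w 0 3) + cim (w 0 1) * cre (v 0 3))
         - (cre (v 0 1) * cim (w 0 3) + cre (w 0 1) * cim (v 0 3)));
      2 * (cre (v 0 0) * cre (w 0 3) + cre (w 0 0) * cre (v 0 3)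
         + (cim (v 0 0) * cim (w 0 3) + cim (w 0 0) * cim (v 0 3))
         - (cre (v 0 1) * cre (w 0 2) + cre (w 0 1) * cre (v 0 2))
         - (cim (v 0 1) * cim (w 0 2) + cim (w 0 1) * cim (v 0 2)));
      2 * (cre (v 0 0) * cim (w 0 3) + cre (w 0 0) * cim (v 0 3)
         - (cim (v 0 0) * cre (w 0 3) + cim (w 0 0) * cre (v 0 3))
         - (cim (v 0 1) * cre (w 0 2) + cim (w 0 1) * cre (v 0 2))
         + (cre (v 0 1) * cim (w 0 2) + cre (w 0 1) * cim (v 0 2)));
      2 * (cre (v 0 0) * cre (w 0 0) + cim (v 0 0) * cim (w 0 0)
         + (cre (v 0 1) * cre (w 0 1) + cim (v 0 1) * cim (w 0 1))
         - (cre (v 0 2) * cre (w 0 2) + cim (v 0 2) * cim (w 0 2))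
         - (cre (v 0 3) * cre (w 0 3) + cim (v 0 3) * cim (w 0 3)))]`_i.
Proof.
rewrite qpolE !hopfE !addE1 !cplxE; gen_coords v; gen_coords w => *.
by case: i => -[|[|[|[|[|//]]]]] ilt /=; ring.
Qed.

Lemma npolR v w : npol v w =
  2 * (cre (v 0 0) * cre (w 0 0) + cim (v 0 0) * cim (w 0 0)
     + (cre (v 0 1) * cre (w 0 1) + cim (v 0 1) * cim (w 0 1))
     + (cre (v 0 2) * cre (w 0 2) + cim (v 0 2) * cim (w 0 2))
     + (cre (v 0 3) * cre (w 0 3) + cim (v 0 3) * cim (w 0 3))).
Proof.
rewrite /npol /hnorm2 !addE1 !cplxE; gen_coords v; gen_coords w => *; ring.
Qed.

Lemma cre_hdot v w : cre (hdot v w) =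
  cre (v 0 0) * cre (w 0 0) + cim (v 0 0) * cim (w 0 0)
  + (cre (v 0 1) * cre (w 0 1) + cim (v 0 1) * cim (w 0 1))
  + (cre (v 0 2) * cre (w 0 2) + cim (v 0 2) * cim (w 0 2))
  + (cre (v 0 3) * cre (w 0 3) + cim (v 0 3) * cim (w 0 3)).
Proof. by rewrite hdotE !cplxE; ring. Qed.

Lemma cim_hdot v w : cim (hdot v w) =
  cim (v 0 0) * cre (w 0 0) - cre (v 0 0) * cim (w 0 0)
  + (cim (v 0 1) * cre (w 0 1) - cre (v 0 1) * cim (w 0 1))
  + (cim (v 0 2) * cre (w 0 2) - cre (v 0 2) * cim (w 0 2))
  + (cim (v 0 3) * cre (w 0 3) - cre (v 0 3) * cim (w 0 3)).
Proof. by rewrite hdotE !cplxE; ring. Qed.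

Lemma hopf_polar p v w :
  \sum_i qpol p v 0 i * qpol p w 0 i - npol p v * npol p w =
  4 * cre (hdot v w * hdot p p - hdot v p * hdot p w)
  - 4 * cre (omega p v * (omega p w)^*).
Proof.
rewrite !big_ord_recl big_ord0 !qpolR /= !npolR creD creN !creM creJ cimJ.
rewrite !cre_hdot !cim_hdot /omega !cplxE.
gen_coords p; gen_coords v; gen_coords w => *; ring.
Qed.

Definition jmap p : 'rV[C]_4 :=
  \row_k [:: - (p 0 1)^*; (p 0 0)^*; - (p 0 3)^*; (p 0 2)^*]`_k.

Lemma jE p : (jmap p 0 0 = - (p 0 1)^*) * (jmap p 0 1 = (p 0 0)^*) *
  (jmap p 0 2 = - (p 0 3)^*) * (jmap p 0 3 = (p 0 2)^*).
Proof. by rewrite !mxE. Qed.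

Lemma hdot_j p v : hdot v (jmap p) = - omega p v.
Proof. by rewrite hdotE !jE /omega !rmorphN /= !conjCK; ring. Qed.

Lemma hdot_pj p : hdot p (jmap p) = 0.
Proof. by rewrite hdot_j /omega; ring. Qed.

Lemma hdot_scale (c : C) v w : hdot v (c *: w) = c^* * hdot v w.
Proof.
rewrite /hdot mulr_sumr; apply: eq_bigr => i _.
by rewrite mxE rmorphM /= mulrCA.
Qed.

Lemma hdot_norm p : hdot p p = (hnorm2 p)%:C%C.
Proof.
apply: cplx_eq; rewrite ?crer ?cimr ?cre_hdot ?cim_hdot /hnorm2 ?sqmodE; ring.
Qed.

Lemma is_derive_quad (a b c : R) :
  is_derive (0 : R) 1 (fun t : R => a + t * b + t ^+ 2 * c) b.
Proof.
apply: is_derive_eq.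
by rewrite /GRing.scale /=; ring.
Qed.

Lemma vertical_qpol p w i : p != 0 -> vertical p w ->
  hnorm2 p * qpol p w 0 i = npol p w * hopf p 0 i.
Proof.
move=> p0 [df Df].
have N0 := lt0r_neq0 (hnorm2_gt0 p0).
have dfi := (derivable_mxP _ _ _).1 df 0 i.
pose g (t : R) : R := htwistor (p + t%:C%C *: w) 0 i.
have g0 : is_derive (0 : R) 1 g 0.
  split; first exact: dfi.
  by move: Df; rewrite derive_mx// => /rowP/(_ i); rewrite !mxE.
have E : (fun t : R => hopf p 0 i + t * qpol p w 0 i + t ^+ 2 * hopf w 0 i) =
   (fun t : R => g t * (hnorm2 p + t * npol p w + t ^+ 2 * hnorm2 w)).
  apply/funext => t; rewrite -hopf_line -hnorm2_line /g hopf_norm [in RHS]mxE.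
  have [->|u0] := eqVneq (p + t%:C%C *: w) 0.
    have H0 : (0 : C) = (0 : R)%:C%C by [].
    rewrite hopfE /hnorm2 !mxE !sqmodE H0 !crer !cimr.
    by case: i {g dfi g0} => -[|[|[|[|[|//]]]]] ilt /=; ring.
  by rewrite mulrAC mulVf ?mul1r// lt0r_neq0 ?hnorm2_gt0.
have D1 := is_derive_quad (hopf p 0 i) (qpol p w 0 i) (hopf w 0 i).
have D2 := is_derive_quad (hnorm2 p) (npol p w) (hnorm2 w).
have D3 := is_deriveM g0 D2.
have := @derive_val _ _ _ _ _ _ _ D1.
rewrite E => <-; have -> := @derive_val _ _ _ _ _ _ _ D3.
rewrite /GRing.scale /= /g scale0r addr0 hopf_norm [in LHS]mxE.
by rewrite /=; field.
Qed.


Lemma scaleE (c : C) v i : (c *: v) 0 i = c * v 0 i.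
Proof. by rewrite mxE. Qed.

Lemma hopf_j p c i : hopf (p + c *: jmap p) 0 i = (1 + sqmod c) * hopf p 0 i.
Proof.
rewrite !hopfE !addE1 !scaleE !jE !cplxE.
gen_coords p => *.
by case: i => -[|[|[|[|[|//]]]]] ilt /=; ring.
Qed.

Lemma hnorm2_j p c : hnorm2 (p + c *: jmap p) = (1 + sqmod c) * hnorm2 p.
Proof.
rewrite /hnorm2 !addE1 !scaleE !jE !cplxE.
gen_coords p => *; ring.
Qed.

Lemma htwistor_j p c : htwistor (p + c *: jmap p) = htwistor p.
Proof.
have c0 : 1 + sqmod c != 0 by rewrite gt_eqF// ltr_pwDl// sqmod_ge0.
rewrite !hopf_norm; apply/rowP => i; rewrite [LHS]mxE [RHS]mxE hopf_j hnorm2_j.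
by rewrite invfM mulrACA mulVf// mul1r.
Qed.

Lemma vertical_j p c : vertical p (c *: jmap p).
Proof.
rewrite /vertical.
have -> : (fun t : R => htwistor (p + t%:C%C *: (c *: jmap p))) = cst (htwistor p).
  by apply/funext => t /=; rewrite scalerA htwistor_j.
exact: is_derive_cst.
Qed.

Lemma horizontal_atP p v : p != 0 -> horizontal_at p v <-> omega p v = 0.
Proof.
move=> p0; have N0 := lt0r_neq0 (hnorm2_gt0 p0).
split=> [H|H w wv]; last first.
  rewrite /fubini_study.
  suff -> : cre (hdot v w * hdot p p - hdot v p * hdot p w) = 0 by rewrite mul0r.
  have := hopf_polar p v w; rewrite H mul0r.
  have -> : cre (0 : C) = 0 by [].
  have -> : \sum_i qpol p v 0 i * qpol p w 0 i = npol p v * npol p w.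
    apply: (mulfI N0); rewrite mulr_sumr mulrA -hopf_sq mulr_suml.
    apply: eq_bigr => i _; rewrite mulrCA (vertical_qpol _ p0 wv); ring.
  by rewrite subrr mulr0 subr0 => /esym/eqP; rewrite mulf_eq0 pnatr_eq0 => /eqP.
have K c : cre (c^* * (omega p v)) = 0.
  have := H _ (vertical_j p c); rewrite /fubini_study => /eqP.
  rewrite mulf_eq0 invr_eq0 expf_eq0 /= (negbTE N0) orbF => /eqP.
  have -> : hdot v (c *: jmap p) * hdot p p - hdot v p * hdot p (c *: jmap p) =
     - (c^* * omega p v * (hnorm2 p)%:C%C).
    by rewrite !hdot_scale hdot_pj hdot_j hdot_norm mulr0 mulr0 subr0 mulrN mulNr.
  rewrite !creN creM crer cimr mulr0 subr0 => /eqP.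
  by rewrite oppr_eq0 mulf_eq0 (negbTE N0) orbF => /eqP.
have := K 1; have := K (0 +i* 1)%C.
by case: (omega p v) => a b; rewrite !creM !creJ !cimJ /cre /cim /= => *; apply: cplx_eq; rewrite /cre /cim /=; lra.
Qed.
Section Curves.
Variable d : nat.
Implicit Types f : 'M[C]_(4, d.+1).

Definition wronskian f : {poly C} :=
  (hpoly f 0)^`() * hpoly f 1 - hpoly f 0 * (hpoly f 1)^`() +
  (hpoly f 2)^`() * hpoly f 3 - hpoly f 2 * (hpoly f 3)^`().

Lemma omega_hlift f z c :
  omega (hlift f z) (c *: hdlift f z) = c * (wronskian f).[z].
Proof.
rewrite /omega !scaleE !mxE /wronskian !(hornerD, hornerN, hornerM). ring.
Qed.

Lemma hlift_flip0 f i : hlift (flip f) 0 0 i = (hpoly f i)`_d.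
Proof.
rewrite mxE horner_coef0 !(coef_rVpoly_ord _ ord0) (coef_rVpoly_ord _ ord_max).
rewrite !mxE; congr (f _ _); apply: val_inj => /=; by rewrite subn1.
Qed.

Lemma hdlift_flip0 f i : hdlift (flip f) 0 0 i = (hpoly f i)`_d.-1 *+ (0 < d)%N.
Proof.
rewrite mxE horner_coef0 coef_deriv mulr1n /hpoly !coef_rVpoly.
case: insubP => [j _ j1|]; case: insubP => [k _ k1|] /=; rewrite -?leqNgt.
- rewrite !mxE; have d0 : (0 < d)%N by move: (ltn_ord j); rewrite j1 ltnS.
  by rewrite d0 mulr1n; congr (f _ _); apply: val_inj; rewrite /= j1 k1 subSS subn1.
- by rewrite ltnNge leq_pred.
- by move=> d0; rewrite (_ : (0 < d)%N = false) ?mulr0n//; apply/negbTE; rewrite -leqNgt -ltnS.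
- by rewrite mul0rn.
Qed.

Lemma size_hpoly f i : (size (hpoly f i) <= d.+1)%N.
Proof. exact: size_poly. Qed.
End Curves.

Lemma coef_derivM (a b : {poly C}) e : (size a <= e.+2)%N -> (size b <= e.+2)%N ->
  (a^`() * b)`_(e + e) = e.+1%:R * (a`_e.+1 * b`_e) + e%:R * (a`_e * b`_e.+1).
Proof.
move=> sa sb; rewrite coefM.
have e1 : (e < (e + e).+1)%N by rewrite ltnS leq_addr.
rewrite (bigD1 (Ordinal e1))//= coef_deriv addnK; congr (_ + _).
  by rewrite mulr_natl mulrnAl.
case: e sa sb e1 => [|e] sa sb e1.
  by rewrite mul0r big1// => -[i /= ilt]; case: i ilt.
have e2 : (e < (e.+1 + e.+1).+1)%N by lia.
rewrite (bigD1 (Ordinal e2))//=; last by apply/eqP => /(congr1 val) /=; lia.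
rewrite coef_deriv big1 ?addr0.
  rewrite (_ : (e.+1 + e.+1 - e = e.+2)%N) ?mulr_natl ?mulrnAl//.
  by lia.
move=> [i /= ilt] /andP[/eqP ne /eqP ne']; rewrite coef_deriv.
have {}ne : i <> e.+1 by move=> E; apply: ne; apply: val_inj.
have {}ne' : i <> e by move=> E; apply: ne'; apply: val_inj.
have [le|lt] := leqP i e.
  have {}le : (i < e)%N by rewrite ltn_neqAle le andbT; apply/eqP.
  rewrite [b`__]nth_default ?mulr0//; apply: leq_trans sb _.
  by lia.
by rewrite [a`__]nth_default ?mul0rn ?mul0r//; apply: leq_trans sa _; lia.
Qed.

Section Curves2.
Variable d : nat.
Implicit Types f : 'M[C]_(4, d.+1).

Lemma omega_infty f c : wronskian f = 0 ->
  omega (hlift (flip f) 0) (c *: hdlift (flip f) 0) = 0.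
Proof.
move=> W0; rewrite /omega !scaleE !hlift_flip0 !hdlift_flip0.
case: d f W0 => [|e] f W0 /=; first by rewrite !mulr0n; ring.
rewrite !mulr1n.
have := congr1 (fun q : {poly C} => q`_(e + e)) W0.
rewrite /wronskian [hpoly f 0 * _]mulrC [hpoly f 2 * _]mulrC.
rewrite !(coefD, coefN) !coef_derivM ?size_hpoly// coef0 -!natr1 => E.
move: E; move: (_`_e.+1) (_`_e.+1) (_`_e.+1) (_`_e.+1) => x1 x2 x3 x4.
move: (_`_e) (_`_e) (_`_e) (_`_e) => y1 y2 y3 y4 E.

rewrite -[RHS](mulr0 (- c)) -[X in _ = _ * X]E; ring.
Qed.

Lemma heval_neq0 f x : holomorphic_coords f -> heval f x != 0.
Proof.
move=> [nocz deg]; case: x => [z|] /=.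
  have [i /rootP/eqP ri] := nocz z; apply: contra_neq ri => /rowP/(_ i).
  by rewrite !mxE.
apply/eqP => f0.
have s i : (size (hpoly f i) <= d)%N.
  have := size_hpoly f i; rewrite leq_eqVlt ltnS => /orP[/eqP si|//].
  have := congr1 (fun v : 'rV[C]_4 => v 0 i) f0; rewrite hlift_flip0 mxE => l0.
  have : lead_coef (hpoly f i) = 0 by rewrite lead_coefE si.
  by move/eqP; rewrite lead_coef_eq0 => /eqP e0; rewrite e0 size_poly0.
have [d0|d0] := posnP d.
  have [i0 ] := nocz 0; rewrite (_ : hpoly f i0 = 0) ?root0//.
  by apply/eqP; rewrite -size_poly_leq0 -[X in (_ <= X)%N]d0.
have : (d <= d.-1)%N.
  rewrite -{1}deg; apply/bigmax_leqP => i _.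
  by have := s i; lia.
by lia.
Qed.

Lemma infinitely_many_roots (q : {poly C}) : (forall z, q.[z] = 0) -> q = 0.
Proof.
move=> q0; apply/eqP; apply: contraT => qn0.
have := @max_poly_roots _ q [seq (i%:R : C) | i <- iota 0 (size q)] qn0.
rewrite size_map size_iota ltnn => -> //.
  by apply/allP => z _; apply/rootP.
by rewrite map_inj_uniq ?iota_uniq// => i j /eqP; rewrite eqr_nat => /eqP.
Qed.

Lemma horizontalP f : holomorphic_coords f ->
  horizontal f <-> wronskian f = 0.
Proof.
move=> hf; split=> [[H _]|W0].
  apply: infinitely_many_roots => z.
  have /horizontal_atP := H z 1; rewrite omega_hlift mul1r; apply.
  exact: (heval_neq0 (Some z) hf).
split=> [z c|c]; apply/horizontal_atP.
- exact: (heval_neq0 (Some z) hf).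
- by rewrite omega_hlift W0 horner0 mulr0.
- exact: (heval_neq0 None hf).
- exact: omega_infty.
Qed.

Lemma hpolyZ (c : C) f i : hpoly (c *: f) i = c *: hpoly f i.
Proof. by rewrite /hpoly linearZ /= linearZ. Qed.

Lemma hevalZ (c : C) f x : heval (c *: f) x = c *: heval f x.
Proof.
apply/rowP => i; case: x => [z|]; first by rewrite !mxE hpolyZ hornerZ.
by rewrite [RHS]mxE !hlift_flip0 hpolyZ coefZ.
Qed.

Lemma CP3_ofZ (c : C) v : c != 0 -> v != 0 -> CP3_of (c *: v) = CP3_of v.
Proof.
move=> c0 v0; apply/eqmodP => /=; apply/asboolP; exists c => //.
have v1 : v \in @nonzero C 1 4 by exact: mem_set.
have cv1 : c *: v \in @nonzero C 1 4.
  by apply/mem_set; rewrite /nonzero /= scaler_eq0 negb_or c0.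
by rewrite (insubdK _ cv1) (insubdK _ v1).
Qed.

Lemma curve_pclass (f : @nonzero C 4 d.+1) x : holomorphic_coords (val f) ->
  curve (pclass f) x = CP3_of (heval (val f) x).
Proof.
move=> hf; rewrite /curve; have [c c0 ->] := hcoord_pclass f.
by rewrite hevalZ CP3_ofZ// heval_neq0.
Qed.

Lemma twistor_curve (f : @nonzero C 4 d.+1) x : holomorphic_coords (val f) ->
  val (twistor (curve (pclass f) x)) = htwistor (heval (val f) x).
Proof.
move=> hf; rewrite curve_pclass// /CP3_of twistor_pclass insubdK//.
exact/mem_set/heval_neq0.
Qed.

Lemma linearly_full_curve (f : @nonzero C 4 d.+1) :
  holomorphic_coords (val f) ->
  linearly_full (curve (pclass f)) <->
  forall a : 'cV[C]_4, a != 0 -> exists x, heval (val f) x *m a != 0.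
Proof.
move=> hf; have E x (a : 'cV[C]_4) : (hcoord (curve (pclass f) x) *m a != 0) =
    (heval (val f) x *m a != 0).
  rewrite curve_pclass// /CP3_of; set v := insubd _ _.
  have [c c0 ->] := hcoord_pclass v.
  rewrite -scalemxAl scaler_eq0 (negbTE c0) /v insubdK//.
  exact/mem_set/heval_neq0.
by split=> H a a0; have [x] := H a a0; exists x; rewrite ?E// -E.
Qed.
End Curves2.
End Criteria.

(* Main.v *)
Require Import Defs.
From mathcomp Require Import all_boot all_order all_algebra.
From mathcomp Require Import all_classical all_reals all_analysis.
From mathcomp.real_closed Require Import complex.
From mathcomp Require Import ring lra zify.
Import Order.TTheory GRing.Theory Num.Theory.
Import numFieldNormedType.Exports.
Set Implicit Arguments.
Unset Strict Implicit.
Unset Printing Implicit Defensive.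
Local Open Scope classical_set_scope.
Local Open Scope ring_scope.

(** A curve of degree 5 is given by the matrix f of the coefficients of its four
    components, and a path of curves by a path of such matrices. Three ideas turn
    the matrices of the antipodally invariant curves into something explicit.

    Reality. The quaternionic structure j of C^4 preserves the fibres of the
    twistor fibration, and a vector lies over the same point as v exactly when it
    is in the span of v and j v. For an invariant curve f, the curve
    sigma f (z) = z^5 j(f(-1 / conj z)) therefore stays in the fibre of f(z). This
    is an identity between polynomials in z and conj z that is linear in the
    conjugate of f. Since the components of f are linearly independent, it can be
    polarized, and says that sigma f and f are proportional ([polarization],
    [same_twistor_minors], [proportional_lifts]). In odd degree sigma is an
    antilinear involution, so f can be rescaled to satisfy sigma f = f
    ([AHHol_good]). Then f = (p, sigma p, q, sigma q) for two polynomials p and q,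
    and horizontality becomes W(p, sigma p) + W(q, sigma q) = 0, with W the
    Wronskian.

    Normal form. The similitudes of the quaternionic plane act on the pairs (p, q)
    and preserve all the conditions. Explicit paths of similitudes bring a pair to
    p = 1 + a z + b z^2 and q = y z + w1 z^2 + w2 z^3 with y > 0: the missing
    coefficients of p vanish because of the lowest coefficients of the Wronskian
    ([joined_q0], [joined_p0], [q1_neq0], [joined_q1]). The other coefficients of
    the Wronskian determine w1, w2 and then y^2, which is the positive root of a
    quadratic equation; such a root exists and is unique for all complex numbers
    a and b ([model_sq_gt0], [model_sq_unique]). So up to similitudes the horizontal
    real lifts are parametrized by C^2, and it remains to see which of them have
    no common zero: all but those with |b| = 1 and a + conj(a) b = 0
    ([heval_reduced], [singular_root]).

    Contraction. These exceptional pairs (a, b) form a Moebius band in a real space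
    of dimension 4, and its complement is connected to the origin by at most four
    segments ([joined_model0]).

    Finally, a harmonic map in AHarm_plus or AHarm_minus is the image, under the
    twistor fibration up to sign, of an invariant curve, and a path of lifts gives
    a path of maps in the compact-open topology ([image_maps_path]). *)

(** * Indices and complex scalars *)

Lemma ord4P (P : 'I_4 -> Prop) : P 0 -> P 1 -> P 2 -> P 3 -> forall i, P i.
Proof.
move=> P0 P1 P2 P3 [[|[|[|[|//]]]] ilt].
- by rewrite (_ : Ordinal ilt = 0)//; exact: val_inj.
- by rewrite (_ : Ordinal ilt = 1)//; exact: val_inj.
- by rewrite (_ : Ordinal ilt = 2)//; exact: val_inj.
- by rewrite (_ : Ordinal ilt = 3)//; exact: val_inj.
Qed.

Lemma ord6P (P : 'I_6 -> Prop) :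
  (forall k (k6 : (k < 6)%N), P (Ordinal k6)) -> forall j, P j.
Proof. by move=> H [k k6]. Qed.

Lemma sum4 (V : nmodType) (F : 'I_4 -> V) : \sum_k F k = F 0 + F 1 + F 2 + F 3.
Proof.
rewrite !big_ord_recl big_ord0 addr0 !addrA.
by do !congr (_ + _); congr (F _); apply: val_inj.
Qed.

Section Scalars.
Variable R : realType.
Local Notation C := (cplx R).

Lemma mul_conj_sqmod (z : C) : z * z^* = (sqmod z)%:C%C.
Proof. by apply: cplx_eq; rewrite !cplxE; ring. Qed.

Lemma conj0 : (0 : C)^* = 0. Proof. exact: rmorph0. Qed.
Lemma conj_nat n : (n%:R : C)^* = n%:R. Proof. exact: rmorph_nat. Qed.
Lemma conjM (z w : C) : (z * w)^* = z^* * w^*. Proof. exact: rmorphM. Qed.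
Lemma conjD (z w : C) : (z + w)^* = z^* + w^*. Proof. exact: rmorphD. Qed.
Lemma conjN (z : C) : (- z)^* = - z^*. Proof. exact: rmorphN. Qed.
Lemma conjK (z : C) : z^*^* = z. Proof. exact: conjCK. Qed.

Lemma of_real_eq0 (x : R) : ((x%:C%C : C) == 0) = (x == 0).
Proof. by rewrite eq_complex /= eqxx andbT. Qed.

Lemma of_realD (x y : R) : ((x + y)%:C%C : C) = x%:C%C + y%:C%C.
Proof. exact: rmorphD. Qed.

Lemma of_realM (x y : R) : ((x * y)%:C%C : C) = x%:C%C * y%:C%C.
Proof. exact: rmorphM. Qed.

Lemma conj_of_real (x : R) : (x%:C%C : C)^* = x%:C%C.
Proof. by apply: cplx_eq; rewrite !cplxE ?oppr0. Qed.

Lemma of_real_lt1 (x : R) : ((x%:C%C : C) < 1) = (x < 1).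
Proof. exact: (@ltcR R x 1). Qed.

Lemma of_real_le1 (x : R) : ((x%:C%C : C) <= 1) = (x <= 1).
Proof. exact: (@lecR R x 1). Qed.

Lemma lt1_of_real (x : R) : (1 < (x%:C%C : C)) = (1 < x).
Proof. exact: (@ltcR R 1 x). Qed.
End Scalars.

(** * Continuity *)

Section ComplexContinuity.
Variable R : realType.
Local Notation C := (cplx R).

Lemma near_dist (K : numFieldType) (V : pseudoMetricNormedZmodType K) (x : V) (e : K) :
  0 < e -> \forall y \near x, `|x - y| < e.
Proof. by move=> e0; apply: (@cvgr_dist_lt _ _ _ _ _ id x _ e e0); exact: cvg_id. Qed.

Lemma norm_cplx_real (t : R) : `|t%:C%C : C| = (`|t|)%:C%C.
Proof. by rewrite normc_def /= expr0n addr0 sqrtr_sqr. Qed.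

Lemma norm_cre (z : C) : ((`|cre z|)%:C%C : C) <= `|z|.
Proof.
rewrite normc_def lecR -sqrtr_sqr ler_wsqrtr//.
by rewrite lerDl sqr_ge0.
Qed.
Lemma norm_cim (z : C) : ((`|cim z|)%:C%C : C) <= `|z|.
Proof.
rewrite normc_def lecR -sqrtr_sqr ler_wsqrtr//.
by rewrite lerDr sqr_ge0.
Qed.

Lemma continuous_of_real : continuous (fun t : R => t%:C%C : C).
Proof.
move=> t; apply/cvgrPdist_lt => e e0.
have [e1 ereal] : 0 < cre e /\ e = (cre e)%:C%C.
  by move: e0; case: e => a b; rewrite ltcE /= => /andP[/eqP -> ->].
apply: filterS (@near_dist R R t _ e1) => s /=.
by rewrite -raddfB/= norm_cplx_real ereal ltcR.
Qed.

Lemma continuous_cre : continuous (@cre R).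
Proof.
move=> z; apply/(@cvgrPdist_lt _ _ _ (nbhs z) (nbhs_filter z)) => e e0.
have e1 : 0 < (e%:C%C : C) by rewrite ltcR.
have := @near_dist C C z _ e1; apply: filterS => w zw.
by rewrite -creN -creD -ltcR; apply: le_lt_trans (norm_cre _) _.
Qed.

Lemma continuous_cim : continuous (@cim R).
Proof.
move=> z; apply/(@cvgrPdist_lt _ _ _ (nbhs z) (nbhs_filter z)) => e e0.
have e1 : 0 < (e%:C%C : C) by rewrite ltcR.
have := @near_dist C C z _ e1; apply: filterS => w zw.
by rewrite -cimN -cimD -ltcR; apply: le_lt_trans (norm_cim _) _.
Qed.

Lemma continuous_conj : continuous (fun z : C => z^*).
Proof.
move=> z; apply/(@cvgrPdist_lt _ _ _ (nbhs z) (nbhs_filter z)) => e e0.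
have := @near_dist C C z _ e0; apply: filterS => w /=.
by rewrite -rmorphB norm_conjC.
Qed.

Lemma continuous_mx (T : topologicalType) (U : topologicalType) m n
    (F : T -> 'M[U]_(m, n)) :
  (forall i j, continuous (fun t => F t i j)) -> continuous F.
Proof.
move=> cF t A [P nP PA].
have h i j : nbhs t [set s | P i j (F s i j)] by exact: cF (nP i j).
have : \forall s \near t, forall i j, P i j (F s i j).
  by apply: filter_forall => i; apply: filter_forall => j; exact: h.
by apply: filterS => s hs; exact: PA.
Qed.

Lemma continuous_entry m n (U : topologicalType) i j :
  continuous (fun M : 'M[U]_(m, n) => M i j).
Proof.
move=> M A nA; exists (fun k l => [set x | k = i -> l = j -> A x]); last first.
  by move=> N /= /(_ i j); apply.
move=> k l; case: (pselect (k = i /\ l = j)) => [[-> ->]|H].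
  by apply: filterS nA => x Ax _ _.
by apply: filterS filterT => x _ ki lj; case: H.
Qed.

Lemma continuous_sub (T U : topologicalType) (A : set U) (F : T -> A) :
  continuous (fun t => val (F t)) -> continuous F.
Proof.
move=> cF; apply/continuousP => _ [B oB <-].
by move/continuousP: cF => /(_ _ oB).
Qed.

Lemma continuous_val (U : topologicalType) (A : set U) :
  continuous (fun x : A => val x).
Proof. exact: initial_continuous. Qed.

End ComplexContinuity.

Section Rules.
Variables (K : numFieldType) (T : topologicalType).
Implicit Types f g : T -> K.

Lemma cts_id : continuous (fun x : T => x).
Proof. by move=> x; exact: cvg_id. Qed.
Lemma cts_cst (U : topologicalType) (a : U) : continuous (fun _ : T => a).
Proof. by move=> x; apply: cvg_cst. Qed.
Lemma cts_add f g : continuous f -> continuous g -> continuous (fun x => f x + g x).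
Proof. by move=> cf cg x; apply: (@cvgD K K^o); [exact: cf|exact: cg]. Qed.
Lemma cts_opp f : continuous f -> continuous (fun x => - f x).
Proof. by move=> cf x; apply: (@cvgN K K^o); exact: cf. Qed.
Lemma cts_mul f g : continuous f -> continuous g -> continuous (fun x => f x * g x).
Proof. by move=> cf cg x; apply: cvgM; [exact: cf|exact: cg]. Qed.
Lemma cts_exp f n : continuous f -> continuous (fun x => f x ^+ n).
Proof.
move=> cf; elim: n => [|n IH]; first by under eq_fun do rewrite expr0; exact: cts_cst.
by under eq_fun do rewrite exprS; exact: cts_mul.
Qed.
Lemma cts_inv f : (forall x, f x != 0) -> continuous f -> continuous (fun x => (f x)^-1).
Proof. by move=> f0 cf x; apply: cvgV; [exact: f0|exact: cf]. Qed.
Lemma cts_sum n (F : 'I_n -> T -> K) : (forall i, continuous (F i)) ->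
  continuous (fun x => \sum_(i < n) F i x).
Proof.
elim: n F => [|n IH] F cF.
  by under eq_fun do rewrite big_ord0; exact: cts_cst.
under eq_fun do rewrite big_ord_recl; apply: cts_add; first exact: cF.
by apply: IH => i; exact: cF.
Qed.
Lemma cts_comp (U V : topologicalType) (h : U -> V) (f : T -> U) :
  continuous h -> continuous f -> continuous (fun x => h (f x)).
Proof. by move=> ch cf x; apply: continuous_comp; [exact: cf|exact: ch]. Qed.
Lemma cts_entry (U : topologicalType) m n (F : T -> 'M[U]_(m, n)) i j :
  continuous F -> continuous (fun x => F x i j).
Proof.
move=> cF; apply: (@cts_comp _ _ (fun M : 'M[U]_(m, n) => M i j)) => //.
exact: continuous_entry.
Qed.
End Rules.

Section Joint.
Variable R : realType.
Local Notation C := (cplx R).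

Section Charts.
Variable T : topologicalType.

Lemma cts_cre (z : T -> C) : continuous z -> continuous (fun x => cre (z x)).
Proof. exact: (cts_comp (@continuous_cre R)). Qed.
Lemma cts_cim (z : T -> C) : continuous z -> continuous (fun x => cim (z x)).
Proof. exact: (cts_comp (@continuous_cim R)). Qed.
Lemma cts_conj (z : T -> C) : continuous z -> continuous (fun x => (z x)^*).
Proof. exact: (cts_comp (@continuous_conj R)). Qed.
Lemma cts_of_real (f : T -> R) :
  continuous f -> continuous (fun t => (f t)%:C%C : C).
Proof. exact: (cts_comp (@continuous_of_real R)). Qed.
Lemma cts_sqmod (z : T -> C) : continuous z -> continuous (fun x => sqmod (z x)).
Proof.
move=> cz; under eq_fun do rewrite sqmodE.
exact: (cts_add (cts_exp (n := 2) (cts_cre cz)) (cts_exp (n := 2) (cts_cim cz))).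
Qed.

Lemma continuous_htwistor (v : T -> 'rV[C]_4) :
  continuous v -> (forall x, v x != 0) -> continuous (fun x => htwistor (v x)).
Proof.
move=> cv v0; have cz k : continuous (fun x => v x 0 k) by exact: cts_entry.
have cs k : continuous (fun x => sqmod (v x 0 k)) by exact: (cts_sqmod (cz k)).
have cp k l : continuous (fun x => (v x 0 k)^* * v x 0 l).
  exact: (cts_mul (cts_conj (cz k)) (cz l)).
have cq k l : continuous (fun x => v x 0 k * (v x 0 l)^*).
  exact: (cts_mul (cz k) (cts_conj (cz l))).
have k2 : continuous (fun _ : T => 2 : C) by exact: cts_cst.
have ca := cts_mul k2 (cts_add (cp 0 2) (cq 1 3)).
have cb := cts_mul k2 (cts_add (cp 0 3) (cts_opp (cq 1 2))).
apply: continuous_mx => i j; rewrite ord1 => {i}.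
have -> : (fun t => htwistor (v t) 0 j) =
    (fun t => (hnorm2 (v t))^-1 * htwistor_num (v t) 0 j).
  by apply/funext => t; rewrite /htwistor [LHS]mxE.
apply: cts_mul.
  apply: cts_inv => [x|]; first exact/lt0r_neq0/hnorm2_gt0.
  exact: (cts_add (cts_add (cts_add (cs 0) (cs 1)) (cs 2)) (cs 3)).
under eq_fun do rewrite mxE.
case: j => -[|[|[|[|[|j]]]]] j5; last by exfalso; exact: (notF j5).
- exact: (cts_cre ca).
- exact: (cts_cim ca).
- exact: (cts_cre cb).
- exact: (cts_cim cb).
- exact: (cts_add (cts_add (cts_add (cs 0) (cs 1)) (cts_opp (cs 2))) (cts_opp (cs 3))).
Qed.

Lemma hliftE d (f : 'M[C]_(4, d.+1)) z i :
  hlift f z 0 i = \sum_(j < d.+1) f i j * z ^+ j.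
Proof.
rewrite mxE /hpoly /rVpoly horner_poly; apply: eq_bigr => j _.
by rewrite valK mxE.
Qed.

Lemma continuous_hlift d (F : T -> 'M[C]_(4, d.+1)) (z : T -> C) :
  continuous F -> continuous z -> continuous (fun x => hlift (F x) (z x)).
Proof.
move=> cF cz; apply: continuous_mx => i j; rewrite ord1.
under eq_fun do rewrite hliftE.
apply: cts_sum => k; apply: cts_mul; last exact: cts_exp.
exact: cts_entry.
Qed.

Lemma continuous_flip d (F : T -> 'M[C]_(4, d.+1)) :
  continuous F -> continuous (fun x => flip (F x)).
Proof.
move=> cF; apply: continuous_mx => i j; under eq_fun do rewrite mxE.
exact: cts_entry.
Qed.
End Charts.

Lemma hlift_flip d (f : 'M[C]_(4, d.+1)) z : z != 0 ->
  hlift f z = z ^+ d *: hlift (flip f) z^-1.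
Proof.
move=> z0; apply/rowP => i; rewrite [RHS]mxE !hliftE mulr_sumr.
rewrite (reindex_inj rev_ord_inj); apply: eq_bigr => j _.
rewrite mxE /= mulrCA; congr (_ * _).
by rewrite subSS expfB_cond ?(negbTE z0) ?leq_ord// exprVn.
Qed.

(** A closed square is the continuous image of a product of two segments; this is
    the only compactness of the complex plane that the point at infinity needs. *)
Lemma compact_square (M : R) :
  compact [set z : C | -M <= cre z <= M /\ -M <= cim z <= M].
Proof.
have c1 : compact (`[-M, M] `*` `[-M, M] : set (R * R)).
  by apply: compact_setX; apply: segment_compact.
suff -> : [set z : C | -M <= cre z <= M /\ -M <= cim z <= M] =
    (fun p : R * R => p.1%:C%C + 'i * p.2%:C%C) @` (`[-M, M] `*` `[-M, M]).
  apply: continuous_compact c1; apply: continuous_subspaceT.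
  apply: cts_add; [|apply: cts_mul; first exact: cts_cst];
    apply: cts_of_real => x.
    exact: cvg_fst.
  exact: cvg_snd.
have E (x y : R) : cre (x%:C%C + 'i * y%:C%C : C) = x /\ cim (x%:C%C + 'i * y%:C%C : C) = y.
  have -> : 'i = (0 +i* 1)%C :> C by [].
  by rewrite !cplxE /cre /cim /=; split; ring.
apply/seteqP; split => [z [hr hi]|z [[x y] [hx hy] ez]].
  exists (cre z, cim z); first by split; rewrite /= in_itv.
  by apply: cplx_eq; [exact: (E _ _).1|exact: (E _ _).2].
have e1 : cre z = x by rewrite -ez; exact: (E x y).1.
have e2 : cim z = y by rewrite -ez; exact: (E x y).2.
by move: hx hy; rewrite /= !in_itv -e1 -e2.
Qed.

(** At infinity the lift is replaced by the one in the chart 1/z, which differs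
    from it by the nonzero scalar z^d and so has the same twistor image. The
    inverse of a large z is small, and large means outside a compact square. *)
Lemma continuous_curve_S4 d (F : R -> 'M[C]_(4, d.+1)) :
  continuous F -> (forall t x, heval (F t) x != 0) ->
  continuous (fun p : R * S2 R => htwistor (heval (F p.1) p.2)).
Proof.
move=> cF F0 [t [z|]] A nA.
  have c : continuous (fun p : R * C => htwistor (hlift (F p.1) p.2)).
    apply: continuous_htwistor => [|p]; last exact: (F0 p.1 (Some p.2)).
    apply: continuous_hlift; last by move=> x; exact: cvg_snd.
    by apply: (cts_comp cF) => x; exact: cvg_fst.
  have [[P Q] [/= nP nQ] PQA] := c (t, z) A nA.
  exists (P, Some @` Q).
    by split => //=; exact: (@one_point_compactification_some_nbhs C).
  by move=> [s [w|]] /= [Ps [//w' Qw' [<-]]]; exact: (PQA (s, w')).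
have c : continuous (fun p : R * C => htwistor (hlift (flip (F p.1)) p.2)).
  apply: continuous_htwistor => [|p].
    apply: continuous_hlift; last by move=> x; exact: cvg_snd.
    by apply: (cts_comp (continuous_flip cF)) => x; exact: cvg_fst.
  have [->|p0] := eqVneq p.2 0; first exact: (F0 p.1 None).
  have := F0 p.1 (Some p.2^-1); rewrite /= hlift_flip ?invr_eq0// invrK.
  by rewrite scaler_eq0 negb_or => /andP[].
have [[P Q] [/= nP nQ] PQA] := c (t, 0) A nA.
have [e /= e0 eQ] : exists2 e : C, 0 < e & ball (0 : C) e `<=` Q.
  by move/nbhs_ballP: nQ => -[e /= e0 eQ]; exists e.
(* |w| > M implies |1/w| < e *)
pose M := (cre e)^-1.
pose K := [set z : C | -M <= cre z <= M /\ -M <= cim z <= M].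
exists (P, (Some @` (~` K)) `|` [set None]).
  split => //=; exists K => //; split; first exact: compact_square.
  apply: compact_closed; last exact: compact_square.
  exact: norm_hausdorff.
move=> [s [w|]] /= [Ps [[w' Kw' [] // ww]|//]]; last first.
  by move=> _; apply: (PQA (s, 0)); split => //=; exact: (@nbhs_singleton C 0 Q).
rewrite -{}ww => {w}.
have e1 : 0 < cre e /\ e = (cre e)%:C%C.
  by move: e0; case: (e) => a b; rewrite ltcE /= => /andP[/eqP -> ->].
have Mw : (M%:C%C : C) < `|w'|.
  have nn (x : R) : (M < `|x|) = ~~ (-M <= x <= M) by rewrite ltNge ler_norml.
  have [H|H] : (M < `|cre w'|) \/ (M < `|cim w'|).
    rewrite !nn; apply/orP; rewrite -negb_and; apply/negP => /andP[h1 h2].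
    by apply: Kw'; split.
  by apply: lt_le_trans (norm_cre _); rewrite ltcR.
  by apply: lt_le_trans (norm_cim _); rewrite ltcR.
have w0 : w' != 0.
  by rewrite -normr_gt0; apply: le_lt_trans Mw; rewrite lecR invr_ge0 ltW ?e1.1.
rewrite hlift_flip// htwistorZ ?expf_neq0//.
apply: (PQA (s, w'^-1)); split => //=; apply: eQ.
rewrite -ball_normE /= sub0r normrN normfV.
rewrite invf_plt ?posrE ?normr_gt0 //.
move: Mw; rewrite /M; congr (_ < _).
by rewrite e1.2 /= fmorphV.
Qed.
End Joint.

(** * Paths of coefficient matrices *)

Section Connection.
Variable R : realType.
Local Notation C := (cplx R).
Variables m n : nat.
Implicit Types (G : set 'M[C]_(m, n)) (f g h : 'M[C]_(m, n)).

(** The path is defined on all of R and takes its values in G everywhere, so that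
    joined paths can be reparametrized without keeping track of [0, 1]. *)
Definition joined G f h : Prop := exists F : R -> 'M[C]_(m, n),
  [/\ continuous F, forall t, G (F t), F 0 = f & F 1 = h].

Definition clamp (t : R) : R := Num.max 0 (Num.min 1 t).

Lemma clamp_itv t : 0 <= clamp t <= 1.
Proof. by rewrite /clamp le_max lexx ge_max ge_min lexx ler01. Qed.

Lemma clamp0 t : t <= 0 -> clamp t = 0.
Proof.
move=> t0; rewrite /clamp (min_idPr _) ?(max_idPl _)//.
exact: le_trans t0 ler01.
Qed.

Lemma clamp1 t : 1 <= t -> clamp t = 1.
Proof. by move=> t1; rewrite /clamp (min_idPl t1) (max_idPr ler01). Qed.

Lemma continuous_clamp : continuous clamp.
Proof.
move=> t; apply: continuous_max; first exact: cvg_cst.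
by apply: continuous_min; [exact: cvg_cst|exact: cvg_id].
Qed.

Lemma joined_path G (F : R -> 'M[C]_(m, n)) : continuous F ->
  (forall t, 0 <= t <= 1 -> G (F t)) -> joined G (F 0) (F 1).
Proof.
move=> cF GF; exists (fun t => F (clamp t)); split.
- exact: (cts_comp cF continuous_clamp).
- by move=> t; apply: GF; exact: clamp_itv.
- by rewrite clamp0.
- by rewrite clamp1.
Qed.

Lemma joined_end G f h : joined G f h -> G h.
Proof. by move=> [F [_ GF _ <-]]; exact: GF. Qed.

Lemma joined_sym G f h : joined G f h -> joined G h f.
Proof.
move=> [F [cF GF <- <-]]; exists (fun t => F (1 - t)); split.
- apply: (cts_comp cF); apply: cts_add; first exact: cts_cst.
  by apply: cts_opp => x; exact: cvg_id.
- by move=> t; exact: GF.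
- by rewrite subr0.
- by rewrite subrr.
Qed.

(** The concatenation is written as the sum of the two reparametrized paths minus
    their common point: at each time one of the two summands sits at that point.
    Continuity then needs no gluing. *)
Lemma joined_trans G g f h : joined G f g -> joined G g h -> joined G f h.
Proof.
move=> [F1 [c1 G1 <- e1]] [F2 [c2 G2 e2 <-]].
pose u (t : R) := clamp (2 * t); pose v (t : R) := clamp (2 * t - 1).
have uv t : v t = 0 \/ u t = 1.
  have [t1|t1] := leP (2 * t) 1; [left; apply: clamp0|right; apply: clamp1]; lra.
have FE t : F1 (u t) + F2 (v t) - g = if v t == 0 then F1 (u t) else F2 (v t).
  have [->|v0] := eqVneq (v t) 0; first by rewrite e2 addrK.
  have [/eqP|->] := uv t; first by rewrite (negbTE v0).
  by rewrite e1 addrC addKr.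
exists (fun t => F1 (u t) + F2 (v t) - g); split.
- have c x : continuous (fun t : R => 2 * t - x : R).
    apply: cts_add; last exact: cts_cst.
    by apply: cts_mul; [exact: cts_cst|move=> y; exact: cvg_id].
  have cu : continuous u.
    apply: (cts_comp continuous_clamp).
    by have := c 0; under eq_fun do rewrite subr0.
  have cv : continuous v by exact: (cts_comp continuous_clamp).
  apply: continuous_mx => i j.
  under eq_fun do rewrite !mxE.
  apply: cts_add; last exact: cts_cst.
  by apply: cts_add; apply: cts_entry; [exact: (cts_comp c1)|exact: (cts_comp c2)].
- by move=> t; rewrite FE; case: ifP.
- by rewrite FE /v /u mulr0 !clamp0 ?eqxx// sub0r lerN10.
- rewrite FE /v /u mulr1 (_ : 2 - 1 = 1 :> R) ?(clamp1 (lexx 1)) ?oner_eq0//; lra.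
Qed.
End Connection.

Section Transfer.
Variable R : realType.
Local Notation C := (cplx R).
Variable d : nat.
Variable G : set 'M[C]_(4, d.+1).
Hypothesis G_hol : forall f, G f -> holomorphic_coords f.
Hypothesis G_joined : forall f h, G f -> G h -> joined G f h.
Hypothesis G_nonempty : exists f, G f.
Hypothesis AHHol_G : forall psi, AHHol R d psi <->
  exists2 f : @nonzero C 4 d.+1, G (val f) & psi = pclass f.

Lemma G_neq0 f : G f -> f \in @nonzero C 4 d.+1.
Proof.
move=> /G_hol hf; apply/mem_set; apply/eqP => f0.
have := heval_neq0 (Some 0) hf; rewrite f0 => /eqP; apply.
by apply/rowP => i; rewrite hliftE mxE big1// => j _; rewrite mxE mul0r.
Qed.

Definition nz (f : 'M[C]_(4, d.+1)) (Gf : G f) : @nonzero C 4 d.+1 :=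
  exist (fun v => v \in @nonzero C 4 d.+1) f (G_neq0 Gf).

Lemma continuous_pclass (F : R -> 'M[C]_(4, d.+1)) (GF : forall t, G (F t)) :
  continuous F -> continuous (fun t => pclass (nz (GF t))).
Proof.
move=> cF; apply: (cts_comp (@pi_continuous _ _)); exact: continuous_sub.
Qed.

Lemma AHHol_path : path_connected R (AHHol R d).
Proof.
split.
  have [f Gf] := G_nonempty; constructor.
  exists (pclass (nz Gf)); apply/mem_set/AHHol_G; by exists (nz Gf).
move=> [x ax] [y ay].
have [f Gf xf] := (AHHol_G x).1 (set_mem ax).
have [h Gh yh] := (AHHol_G y).1 (set_mem ay).
have [F [cF GF F0 F1]] := G_joined Gf Gh.
have mF t : pclass (nz (GF t)) \in AHHol R d.
  by apply/mem_set/AHHol_G; exists (nz (GF t)); first exact: GF.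
exists (fun t => exist (fun p => p \in AHHol R d) (pclass (nz (GF t))) (mF t)); split.
- apply: continuous_subspaceT; apply: continuous_sub.
  exact: (@continuous_pclass F GF cF).
- by apply: val_inj; rewrite /= xf; congr pclass; apply: val_inj; rewrite /= F0.
- by apply: val_inj; rewrite /= yh; congr pclass; apply: val_inj; rewrite /= F1.
Qed.

Lemma continuous_twistor_curve (F : R -> 'M[C]_(4, d.+1)) (GF : forall t, G (F t)) :
  continuous F ->
  continuous (fun p : R * S2 R => twistor (curve (pclass (nz (GF p.1))) p.2)).
Proof.
move=> cF; apply: continuous_sub.
have -> : (fun p : R * S2 R => val (twistor (curve (pclass (nz (GF p.1))) p.2))) =
    (fun p => htwistor (heval (F p.1) p.2)).
  by apply/funext => p; rewrite twistor_curve//; exact/G_hol/GF.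
by apply: continuous_curve_S4 => // t x; exact/heval_neq0/G_hol.
Qed.

Lemma continuous_S4_opp : continuous (@S4_opp R).
Proof.
apply: continuous_sub => /=; apply: continuous_mx => i j.
under eq_fun do rewrite mxE.
by apply: cts_opp; apply: cts_entry; exact: continuous_val.
Qed.

(* With e the identity this is AHarm_plus, with e the antipodal map of S^4 it
   is AHarm_minus. *)
Variable e : S4 R -> S4 R.
Hypothesis e_cont : continuous e.
Hypothesis e_inj : injective e.

Definition image_maps : set {compact-open, S2 R -> S4 R} :=
  [set phi | exists2 psi, HHol R d psi & phi = (fun x => e (twistor (curve psi x)))]
  `&` [set phi | forall x, phi (antipode x) = phi x].

Lemma image_mapsP phi : image_maps phi <-> exists2 f : @nonzero C 4 d.+1,
  G (val f) & phi = (fun x => e (twistor (curve (pclass f) x))).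
Proof.
split.
  move=> [[psi Hpsi ->] inv].
  have /AHHol_G[f Gf psif] : AHHol R d psi.
    by split => // x; apply: e_inj; exact: inv.
  by exists f => //; rewrite psif.
move=> [f Gf ->].
have [Hf Af] : AHHol R d (pclass f) by apply/AHHol_G; exists f.
by split; [exists (pclass f)|move=> x /=; rewrite Af].
Qed.

(** A path of lifts gives a map that is jointly continuous in the parameter and in
    the point of the sphere; currying turns it into a path for the compact-open
    topology. *)
Lemma image_maps_path : path_connected R image_maps.
Proof.
split.
  have [f Gf] := G_nonempty; constructor.
  exists (fun x => e (twistor (curve (pclass (nz Gf)) x))).
  by apply/mem_set/image_mapsP; exists (nz Gf).
move=> [x ax] [y ay].
have [f Gf xf] := (image_mapsP x).1 (set_mem ax).
have [h Gh yh] := (image_mapsP y).1 (set_mem ay).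
have [F [cF GF F0 F1]] := G_joined Gf Gh.
pose g t : {compact-open, S2 R -> S4 R} :=
  fun x => e (twistor (curve (pclass (nz (GF t))) x)).
have mg t : g t \in image_maps.
  by apply/mem_set/image_mapsP; exists (nz (GF t)); first exact: GF.
exists (fun t => exist (fun p => p \in image_maps) (g t) (mg t)); split.
- apply: continuous_subspaceT; apply: continuous_sub.
  have /continuous_curry_fun := cts_comp e_cont (@continuous_twistor_curve F GF cF).
  exact.
- have E : nz (GF 0) = f by apply: val_inj; rewrite /= F0.
  by apply: val_inj; rewrite /= xf -E.
- have E : nz (GF 1) = h by apply: val_inj; rewrite /= F1.
  by apply: val_inj; rewrite /= yh -E.
Qed.
End Transfer.

Lemma path_connected_of_joined (R : realType) d (G : set 'M[cplx R]_(4, d.+1)) :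
  (forall f, G f -> holomorphic_coords f) ->
  (forall f h, G f -> G h -> joined G f h) ->
  (exists f, G f) ->
  (forall psi, AHHol R d psi <->
    exists2 f : @nonzero (cplx R) 4 d.+1, G (val f) & psi = pclass f) ->
  [/\ path_connected R (AHHol R d), path_connected R (AHarm_plus R d) &
   path_connected R (AHarm_minus R d)].
Proof.
move=> G1 G2 G3 G4; split; first exact: (AHHol_path G1 G2 G3 G4).
  apply: (image_maps_path G1 G2 G3 G4 (e := id)) => //.
  by move=> x; exact: cvg_id.
apply: (image_maps_path G1 G2 G3 G4 (e := @S4_opp R)).
  exact: continuous_S4_opp.
by move=> x y /(congr1 val) /= /oppr_inj; exact: val_inj.
Qed.

(** * The antiholomorphic involution *)

Section Involution.
Variable R : realType.
Local Notation C := (cplx R).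

(** Used to pass from an identity valid for real values of a variable to one valid
    for all complex values. *)
Lemma poly_nat_roots (q : {poly C}) : (forall n : nat, q.[n%:R] = 0) -> q = 0.
Proof.
move=> q0; apply/eqP; apply: contraT => qn0.
have := @max_poly_roots _ q [seq (i%:R : C) | i <- iota 0 (size q)] qn0.
rewrite size_map size_iota ltnn => -> //.
  by apply/allP => z /mapP[n _ ->]; apply/rootP.
by rewrite map_inj_uniq ?iota_uniq// => i j /eqP; rewrite eqr_nat => /eqP.
Qed.

Section AnyDegree.
Variable d : nat.
Implicit Types f g : 'M[C]_(4, d.+1).

Lemma coef_hpoly f i (j : 'I_d.+1) : (hpoly f i)`_j = f i j.
Proof. by rewrite /hpoly coef_rVpoly_ord mxE. Qed.

Lemma holomorphic_coordsP f : holomorphic_coords f <-> forall x, heval f x != 0.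
Proof.
split=> [hf x|H]; first exact: heval_neq0.
split=> [z|].
  apply: contrapT => /forallNP h; have /eqP := H (Some z); apply.
  by apply/rowP => i; rewrite !mxE; apply/rootP; apply: contraT => /h.
apply/eqP; rewrite eqn_leq; apply/andP; split.
  by apply/bigmax_leqP => i _; have := size_hpoly f i; case: size.
have /existsNP[i /eqP fi] : ~ (forall i, (hpoly f i)`_d = 0).
  move=> h; have /eqP := H None; apply => /=.
  by apply/rowP => i; rewrite hlift_flip0 h mxE.
apply: leq_trans (leq_bigmax i).
have : (d < size (hpoly f i))%N.
  by rewrite ltnNge; apply: contra fi => h; rewrite nth_default.
by case: size.
Qed.

Lemma linearly_fullP (f : @nonzero C 4 d.+1) : holomorphic_coords (val f) ->
  linearly_full (curve (pclass f)) <-> row_free (val f).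
Proof.
move=> hf; rewrite linearly_full_curve//; set g := val f.
have E x (a : 'cV[C]_4) : (hlift g x *m a) 0 0 = (rVpoly (a^T *m g)).[x].
  rewrite /rVpoly horner_poly mxE.
  under eq_bigr do rewrite hliftE mulr_suml.
  rewrite exchange_big /=; apply: eq_bigr => j _; rewrite valK mxE mulr_suml.
  by rewrite !big_ord_recl !big_ord0 !mxE; ring.
split=> [H|/row_freeP[B gB] a a0].
  apply: inj_row_free => v vg; apply/eqP; apply: contraT => v0.
  have [|x] := H v^T; first by rewrite trmx_eq0.
  move=> /eqP[]; apply/rowP => i; rewrite ord1 [RHS]mxE.
  case: x => [z|] /=; first by rewrite E trmxK vg linear0 horner0.
  rewrite mxE; have := congr1 (fun w : 'rV_d.+1 => w 0 ord_max) vg; rewrite !mxE.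
  move=> e0; rewrite -[RHS]e0; apply: eq_bigr => k _; rewrite hlift_flip0.
  by rewrite -[d in _`_d]/(val (@ord_max d)) coef_hpoly mxE mulrC.
apply: contrapT => /forallNP h.
have /(congr1 (@poly_rV C d.+1)) : rVpoly (a^T *m g) = 0.
  apply: infinitely_many_roots => z; rewrite -E.
  by have /negP/negPn/eqP/= -> := h (Some z); rewrite mxE.
rewrite rVpolyK linear0 => /(congr1 (mulmx^~ B)); rewrite -mulmxA gB mulmx1 mul0mx.
by move=> /eqP; rewrite trmx_eq0 (negbTE a0).
Qed.

(** The coefficients of z^d j(f(-1 / conj z)), for odd d. *)
Definition sigma f : 'M[C]_(4, d.+1) :=
  \matrix_(i, j) ((-1) ^+ j.+1 * jmap (\row_k f k (rev_ord j)) 0 i).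

Lemma jmapZ (c : C) v : jmap (c *: v) = c^* *: jmap v.
Proof.
apply/rowP; elim/ord4P; rewrite [RHS]mxE !jE !mxE rmorphM; ring.
Qed.

Lemma jmapK (v : 'rV[C]_4) : jmap (jmap v) = - v.
Proof.
apply/rowP; elim/ord4P; rewrite [RHS]mxE !jE ?rmorphN/= conjCK//.
Qed.

Lemma htwistor_jmap (v : 'rV[C]_4) : htwistor (jmap v) = htwistor v.
Proof.
have -> : hnorm2 (jmap v) = hnorm2 v -> htwistor_num (jmap v) = htwistor_num v ->
  htwistor (jmap v) = htwistor v by rewrite /htwistor => -> ->.
- by [].
- by rewrite /hnorm2 !jE !cplxE; ring.
- apply/rowP => i; rewrite !hopfE !jE !cplxE.
  by case: i => -[|[|[|[|[|//]]]]] ilt /=; ring.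
Qed.

Lemma jmap_neq0 (v : 'rV[C]_4) : v != 0 -> jmap v != 0.
Proof.
apply: contraNN => /eqP v0; rewrite -oppr_eq0 -jmapK v0.
apply/eqP/rowP; apply: ord4P; rewrite jE !mxE ?conjC0 ?oppr0//.
Qed.

Lemma sigmaZ (c : C) f : sigma (c *: f) = c^* *: sigma f.
Proof.
apply/matrixP => i j; rewrite mxE [RHS]mxE [in RHS]mxE mulrCA; congr (_ * _).
have -> : \row_k (c *: f) k (rev_ord j) = c *: \row_k f k (rev_ord j).
  by apply/rowP => k; rewrite !mxE.
by rewrite jmapZ mxE.
Qed.

Hypothesis odd_d : odd d.

(** The antipode contributes (-1)^d and the quaternionic structure contributes -1. *)
Lemma sigmaK f : sigma (sigma f) = f.
Proof.
apply/matrixP => i j.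
have e : ((-1) ^+ j.+1 * (-1) ^+ (rev_ord j).+1 : C) = -1.
  rewrite -exprD /= subSS.
  have -> : (j.+1 + (d - j).+1)%N = d.+2 by have := ltn_ord j; lia.
  by rewrite -signr_odd /= negbK odd_d.
rewrite mxE.
have -> : \row_k sigma f k (rev_ord j) =
    (-1) ^+ (rev_ord j).+1 *: jmap (\row_k f k j).
  by apply/rowP => k; rewrite !mxE rev_ordK.
rewrite jmapZ mxE rmorphXn rmorphN1 mulrA e jmapK.
by rewrite !mxE; ring.
Qed.

Lemma heval_sigma f x : exists2 c : C, c != 0 &
  heval (sigma f) x = c *: jmap (heval f (antipode x)).
Proof.
case: x => [z|] /=; last first.
  exists 1; rewrite ?oner_neq0// scale1r; apply/rowP => i.
  rewrite hlift_flip0 -[d in _`_d]/(val (@ord_max d)) coef_hpoly mxE.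
  rewrite -signr_odd /= odd_d mul1r; congr (jmap _ 0 i); apply/rowP => k.
  rewrite mxE hliftE big_ord_recl big1 ?addr0 => [|j _].
    by rewrite expr0 mulr1; congr (f k _); apply: val_inj => /=; rewrite subnn.
  by rewrite expr0n mulr0.
have [->|z0] := eqVneq z 0.
  exists (-1); rewrite ?oppr_eq0 ?oner_neq0//; apply/rowP => i.
  rewrite hliftE big_ord_recl big1 ?addr0 => [|j _]; last by rewrite expr0n mulr0.
  rewrite expr0 mulr1 [RHS]mxE mxE expr1; congr (_ * jmap _ 0 i).
  apply/rowP => k; rewrite hlift_flip0 -[d in _`_d]/(val (@ord_max d)) coef_hpoly mxE.
  by congr (f k _); apply: val_inj => /=; rewrite subn1.
exists (z ^+ d); rewrite ?expf_neq0// /=; apply/rowP => i.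
have -> : hlift f (- (z^*)^-1) = \sum_(j < d.+1) ((- (z^*)^-1) ^+ j *: \row_k f k j).
  by apply/rowP => k; rewrite hliftE summxE; apply: eq_bigr => j _; rewrite !mxE mulrC.
have jD : {morph @jmap R : u v / u + v}.
  by move=> u v; apply/rowP; elim/ord4P; rewrite !mxE rmorphD/=; ring.
have j0 : jmap (0 : 'rV[C]_4) = 0.
  by rewrite -[X in jmap X](scale0r 0) jmapZ rmorph0 scale0r.
rewrite (big_morph _ jD j0) [RHS]mxE summxE mulr_sumr hliftE.
rewrite (reindex_inj rev_ord_inj); apply: eq_bigr => j _.
rewrite jmapZ [in RHS]mxE mxE rev_ordK mulrAC mulrA; congr (_ * _).
have -> : ((- (z^*)^-1) ^+ j)^* = (- z^-1) ^+ j :> C.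
  rewrite rmorphXn rmorphN fmorphV; congr ((- _^-1) ^+ j); exact: conjCK.
rewrite /= subSS.
have jd := leq_ord j.
rewrite [in RHS]exprNn exprVn mulrCA -expfB_cond ?(negbTE z0)//.
congr (_ * _); rewrite -signr_odd -[RHS]signr_odd /= oddB// odd_d.
by case: (odd j).
Qed.
End AnyDegree.
End Involution.

(** * Antipodal invariance as a reality condition *)

Section AntipodalInvariance.
Variable R : realType.
Local Notation C := (cplx R).

(** The orthogonal projection of C^4 onto the quaternionic line spanned by v and
    j v has entries that are affine functions of the twistor image of v. Hence a
    vector w over the same point is fixed by that projection; these are the first
    two coordinates of this fact, multiplied out. Each of them is linear in the
    conjugate of v. *)
Lemma fiber_eq (v w : 'rV[C]_4) : v != 0 -> w != 0 -> htwistor v = htwistor w ->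
  w 0 0 * (v 0 2 * (v 0 2)^* + v 0 3 * (v 0 3)^*) =
    w 0 2 * (v 0 0 * (v 0 2)^* + (v 0 1)^* * v 0 3) +
    w 0 3 * (v 0 0 * (v 0 3)^* - (v 0 1)^* * v 0 2) /\
  w 0 1 * (v 0 2 * (v 0 2)^* + v 0 3 * (v 0 3)^*) =
    w 0 2 * (v 0 1 * (v 0 2)^* - (v 0 0)^* * v 0 3) +
    w 0 3 * (v 0 1 * (v 0 3)^* + (v 0 0)^* * v 0 2).
Proof.
move=> v0 w0 vw.
have Nv := lt0r_neq0 (hnorm2_gt0 v0); have Nw := lt0r_neq0 (hnorm2_gt0 w0).
have E i : hnorm2 w * htwistor_num v 0 i = hnorm2 v * htwistor_num w 0 i.
  have e : htwistor v 0 i = htwistor w 0 i by rewrite vw.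
  rewrite /htwistor [LHS]mxE [RHS]mxE in e.
  rewrite -[htwistor_num v 0 i](mulVKf Nv) e; rewrite mulrCA; congr (_ * _).
  by rewrite mulVKf.
have N4 : hnorm2 w * (sqmod (v 0 2) + sqmod (v 0 3)) =
    hnorm2 v * (sqmod (w 0 2) + sqmod (w 0 3)).
  by have := E 4; rewrite !hopfE /= /hnorm2 !sqmodE; lra.
move: (E 0) (E 1) (E 2) (E 3); rewrite !hopfE /= => E0 E1 E2 E3 {E vw v0 w0}.
move: Nv Nw N4 E0 E1 E2 E3; move: (hnorm2 v) (hnorm2 w) => nv nw Nv Nw N4 E0 E1 E2 E3.
have eA : nw%:C%C * ((v 0 0)^* * v 0 2 + v 0 1 * (v 0 3)^*) =
   nv%:C%C * ((w 0 0)^* * w 0 2 + w 0 1 * (w 0 3)^*) :> C.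
  by apply: cplx_eq; rewrite !cplxE; lra.
have eB : nw%:C%C * ((v 0 0)^* * v 0 3 - v 0 1 * (v 0 2)^*) =
   nv%:C%C * ((w 0 0)^* * w 0 3 - w 0 1 * (w 0 2)^*) :> C.
  by apply: cplx_eq; rewrite !cplxE; lra.
have eC : nw%:C%C * (v 0 2 * (v 0 2)^* + v 0 3 * (v 0 3)^*) =
   nv%:C%C * (w 0 2 * (w 0 2)^* + w 0 3 * (w 0 3)^*) :> C.
  by apply: cplx_eq; move: N4; rewrite !cplxE; lra.
have eA' := congr1 (fun z : C => z^*) eA; have eB' := congr1 (fun z : C => z^*) eB.
rewrite /= !(conjM, conjD, conjN, conjK, conj_of_real) in eA' eB'.
have Nw' : (nw%:C%C : C) != 0 by rewrite of_real_eq0.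
split; apply: (mulfI Nw').
  transitivity (w 0 2 * (nw%:C%C * (v 0 0 * (v 0 2)^* + (v 0 1)^* * v 0 3)) +
    w 0 3 * (nw%:C%C * (v 0 0 * (v 0 3)^* - (v 0 1)^* * v 0 2))); last by ring.
  by rewrite eA' eB' mulrCA eC; ring.
transitivity (w 0 3 * (nw%:C%C * ((v 0 0)^* * v 0 2 + v 0 1 * (v 0 3)^*)) -
  w 0 2 * (nw%:C%C * ((v 0 0)^* * v 0 3 - v 0 1 * (v 0 2)^*))); last by ring.
by rewrite eA eB mulrCA eC; ring.
Qed.

Section AnyDegree.
Variable d : nat.
Implicit Types f g : 'M[C]_(4, d.+1).

(** A polynomial identity in z and its conjugate stays true when the two are made
    independent variables: write them as x + i y and x - i y with x and y real, and
    extend to complex x and y one after the other. Then the conjugate polynomials,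
    being linearly independent, have zero coefficients. *)
Lemma polarization f (c : 'I_4 -> {poly C}) : row_free f ->
  (forall z : C, \sum_k (c k).[z] * ((hpoly f k).[z])^* = 0) -> forall k, c k = 0.
Proof.
move=> ff H.
pose b k := map_poly Num.conj (hpoly f k).
have bE k z : (b k).[z] = ((hpoly f k).[z^*])^*.
  rewrite /b -[in LHS](conjCK z); exact: horner_map.
have H1 (x y : R) : \sum_k (c k).[x%:C%C + 'i * y%:C%C] * (b k).[x%:C%C - 'i * y%:C%C] = 0.
  rewrite -[RHS](H (x%:C%C + 'i * y%:C%C)); apply: eq_bigr => k _.
  rewrite bE; congr (_ * (_.[_])^*).
  rewrite rmorphB rmorphM /= conjCi; apply: cplx_eq; rewrite !cplxE; ring.
have nR (n : nat) : (n%:R : C) = (n%:R : R)%:C%C by rewrite rmorph_nat.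
have H2 (x : C) (y : R) : \sum_k (c k).[x + 'i * y%:C%C] * (b k).[x - 'i * y%:C%C] = 0.
  pose q := \sum_k (c k \Po ('X + ('i * y%:C%C)%:P)) * (b k \Po ('X - ('i * y%:C%C)%:P)).
  have qE t : q.[t] = \sum_k (c k).[t + 'i * y%:C%C] * (b k).[t - 'i * y%:C%C].
    rewrite horner_sum; apply: eq_bigr => k _.
    by rewrite hornerM !horner_comp !(hornerD, hornerN, hornerC, hornerX).
  by rewrite -qE (_ : q = 0) ?horner0//; apply: poly_nat_roots => n; rewrite qE nR H1.
have H3 (x y : C) : \sum_k (c k).[x + 'i * y] * (b k).[x - 'i * y] = 0.
  pose q := \sum_k (c k \Po (x%:P + 'i%:P * 'X)) * (b k \Po (x%:P - 'i%:P * 'X)).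
  have qE t : q.[t] = \sum_k (c k).[x + 'i * t] * (b k).[x - 'i * t].
    rewrite horner_sum; apply: eq_bigr => k _.
    by rewrite hornerM !horner_comp !(hornerD, hornerN, hornerM, hornerC, hornerX).
  by rewrite -qE (_ : q = 0) ?horner0//; apply: poly_nat_roots => n; rewrite qE nR H2.
have i0 : 'i != 0 :> C by exact: neq0Ci.
have H4 (z w : C) : \sum_k (c k).[z] * (b k).[w] = 0.
  rewrite -[RHS](H3 ((z + w) / 2) ((z - w) / (2 * 'i))); apply: eq_bigr => k _.
  congr (_.[_] * _.[_]); field; rewrite ?i0 ?pnatr_eq0//.
have H5 z : \row_k ((c k).[z])^* = 0.
  have /row_freeP[B fB] := ff.
  rewrite -[LHS]mulmx1 -fB mulmxA.
  suff -> : \row_k ((c k).[z])^* *m f = 0 by rewrite mul0mx.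
  apply/rowP => j; rewrite [RHS]mxE mxE.
  have q0 : \sum_k (c k).[z] *: b k = 0.
    apply: infinitely_many_roots => w; rewrite horner_sum -[RHS](H4 z w).
    by apply: eq_bigr => k _; rewrite hornerZ.
  have := congr1 (fun p : {poly C} => (p`_j)^*) q0; rewrite coef0 conjC0 => e.
  rewrite -[RHS]e coef_sum rmorph_sum; apply: eq_bigr => k _.
  rewrite coefZ mxE rmorphM /b coef_map; congr (_ * _).
  by rewrite coef_hpoly; symmetry; exact: conjCK.
move=> k; apply: infinitely_many_roots => z.
have := congr1 (fun v : 'rV[C]_4 => v 0 k) (H5 z); rewrite !mxE => /eqP.
by rewrite conjC_eq0 => /eqP.
Qed.

(** In the relations between points of one fibre, the coefficients of the conjugate
    of f are 2 x 2 minors of the two lifts; polarization makes them vanish. The minor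
    of the components 0 and 1 is not among them, but follows from the others by
    cancelling a nonzero component. *)
Lemma same_twistor_minors f g : row_free f ->
  (forall z, hlift f z != 0) -> (forall z, hlift g z != 0) ->
  (forall z, htwistor (hlift f z) = htwistor (hlift g z)) ->
  forall i k, hpoly g i * hpoly f k = hpoly g k * hpoly f i.
Proof.
move=> ff f0 g0 H.
have E z := fiber_eq (f0 z) (g0 z) (H z).
have hl h z i : hlift h z 0 i = (hpoly h i).[z] by rewrite mxE.
pose p := hpoly f; pose q := hpoly g.
have fz i : p i != 0.
  apply/eqP => e; have : row i f = 0.
    by rewrite -[row i f]rVpolyK -[rVpoly _]/(p i) e linear0.
  have /row_freeP[B fB] := ff.
  move=> /(congr1 (mulmx^~ B)); rewrite -row_mul fB mul0mx => /rowP/(_ i).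
  by rewrite !mxE eqxx => /eqP; rewrite oner_eq0.
(* the coefficients of the conjugates of the f_k in the two relations *)
pose c0 k := [:: 0; q 3 * p 2 - q 2 * p 3; q 0 * p 2 - q 2 * p 0;
  q 0 * p 3 - q 3 * p 0]`_(nat_of_ord (k : 'I_4)).
pose c1 k := [:: q 2 * p 3 - q 3 * p 2; 0; q 1 * p 2 - q 2 * p 1;
  q 1 * p 3 - q 3 * p 1]`_(nat_of_ord (k : 'I_4)).
have c00 k : c0 k = 0.
  apply: (polarization ff) => z; have [e _] := E z; rewrite !hl in e.
  rewrite sum4 /c0 /= horner0 !(hornerD, hornerN, hornerM) -/p -/q in e *.
  by move/eqP: e; rewrite -subr_eq0 => /eqP e; rewrite -[RHS]e; ring.
have c10 k : c1 k = 0.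
  apply: (polarization ff) => z; have [_ e] := E z; rewrite !hl in e.
  rewrite sum4 /c1 /= horner0 !(hornerD, hornerN, hornerM) -/p -/q in e *.
  by move/eqP: e; rewrite -subr_eq0 => /eqP e; rewrite -[RHS]e; ring.
have e (a b : {poly C}) : a - b = 0 -> a = b by move/eqP; rewrite subr_eq0 => /eqP.
have e02 := e _ _ (c00 2); have e03 := e _ _ (c00 3); have e32 := e _ _ (c00 1).
have e12 := e _ _ (c10 2); have e13 := e _ _ (c10 3).
have e01 : q 0 * p 1 = q 1 * p 0.
  apply: (mulIf (fz 2)).
  by rewrite mulrAC e02 [RHS]mulrAC e12; ring.
by apply: ord4P; apply: ord4P => //; symmetry.
Qed.

(** Pick a component of f of maximal degree and divide it by its gcd with the
    corresponding component of g: the quotient divides every component of f, so it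
    is constant. Thus g is a polynomial multiple of f, and by the degree bound the
    factor is a constant. *)
Lemma proportional_lifts f g : row_free f -> (forall x, heval f x != 0) -> g != 0 ->
  (forall i k, hpoly g i * hpoly f k = hpoly g k * hpoly f i) ->
  exists2 c : C, c != 0 & g = c *: f.
Proof.
move=> ff f0 g0 H.
have /existsNP[i0 /eqP fi0] : ~ (forall i, (hpoly f i)`_d = 0).
  move=> h; have /eqP := f0 None; apply => /=.
  by apply/rowP => i; rewrite hlift_flip0 h mxE.
have sf : size (hpoly f i0) = d.+1.
  apply/eqP; rewrite eqn_leq size_hpoly /= ltnNge; apply: contra fi0 => h.
  by rewrite nth_default.
have p0 : hpoly f i0 != 0 by rewrite -size_poly_eq0 sf.
pose h := gcdp (hpoly f i0) (hpoly g i0).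
have [u eu] : exists u, hpoly f i0 = u * h by apply/dvdpP; exact: dvdp_gcdl.
have [v ev] : exists v, hpoly g i0 = v * h by apply/dvdpP; exact: dvdp_gcdr.
have h0 : h != 0 by apply: contra_neq p0 => h0; rewrite eu h0 mulr0.
have uv : coprimep u v.
  have := coprimep_div_gcd (_ : (hpoly f i0 != 0) || (hpoly g i0 != 0)).
  by rewrite p0 -/h {1}eu ev !mulpK//; exact.
have udvd k : u %| hpoly f k.
  rewrite -(Gauss_dvdpr _ uv); apply/dvdpP; exists (hpoly g k).
  apply: (mulIf h0); rewrite mulrAC -ev H; rewrite eu; ring.
have su : size u == 1%N.
  apply: contraT => /closed_rootP[z uz].
  have /eqP[] := f0 (Some z); apply/rowP => k; rewrite mxE [RHS]mxE.
  by have /dvdpP[w ->] := udvd k; rewrite hornerM (rootP uz) mulr0.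
have /size_poly1P[b b0 ub] : size u == 1%N by [].
pose l := b^-1 *: v.
have gl k : hpoly g k = l * hpoly f k.
  apply: (mulIf p0); rewrite -H ev eu ub /l.
  rewrite -mul_polyC.
  have : b^-1%:P * b%:P = 1 :> {poly C} by rewrite -polyCM mulVf.
  move=> e; transitivity ((b^-1%:P * b%:P) * (v * h * hpoly f k)); last by ring.
  by rewrite e mul1r.
have l0 : l != 0.
  apply: contra_neq g0 => l0; apply/row_matrixP => i; rewrite row0.
  by rewrite -[row i g]rVpolyK -[rVpoly _]/(hpoly g i) gl l0 mul0r linear0.
have /size_poly1P[c c0 lc] : size l == 1%N.
  have := size_hpoly g i0; rewrite gl size_mul// sf addnS /=.
  by move=> sl; rewrite eqn_leq size_poly_gt0 l0 andbT -(leq_add2r d) add1n.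
exists c => //; apply/matrixP => i j.
by rewrite -coef_hpoly gl lc mul_polyC coefZ coef_hpoly mxE.
Qed.

(** The lifts fixed by sigma. Not vanishing at any point of the sphere, infinity
    included, expresses both the absence of common zeros and maximal degree d. *)
Definition good f : Prop :=
  [/\ sigma f = f, wronskian f = 0, forall x, heval f x != 0 & row_free f].

Hypothesis odd_d : odd d.

Lemma good_AHHol (f : @nonzero C 4 d.+1) : good (val f) -> AHHol R d (pclass f).
Proof.
move=> [sf wf f0 ff]; have hf := (holomorphic_coordsP _).2 f0; split.
  exists f; split => //; first exact/horizontalP.
  exact/linearly_fullP.
move=> x; apply: val_inj; rewrite !twistor_curve//.
have [c c0 e] := heval_sigma odd_d (val f) x.
by rewrite -[in RHS]sf e htwistorZ// htwistor_jmap.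
Qed.

(** By invariance sigma f and f have the same twistor image, hence sigma f = l f.
    As sigma is an antilinear involution, l has modulus 1, and multiplying f by a
    square root of l makes it a fixed point. *)
Lemma AHHol_good psi : AHHol R d psi ->
  exists2 f : @nonzero C 4 d.+1, good (val f) & psi = pclass f.
Proof.
move=> [[f [-> hf Hf Ff]] inv].
have f0 := (holomorphic_coordsP _).1 hf.
have ff := (linearly_fullP hf).1 Ff.
have wf := (horizontalP hf).1 Hf.
pose g := sigma (val f).
have g0 x : heval g x != 0.
  have [c c0 ->] := heval_sigma odd_d (val f) x.
  by rewrite scaler_eq0 (negbTE c0) jmap_neq0.
have fg x : htwistor (heval (val f) x) = htwistor (heval g x).
  have [c c0 e] := heval_sigma odd_d (val f) x.
  rewrite /g e htwistorZ// htwistor_jmap.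
  have := congr1 val (inv x); rewrite !twistor_curve//.
have gn0 : g != 0.
  apply: contra_neq (g0 (Some 0)) => ->.
  by apply/rowP => i; rewrite hliftE mxE big1// => j _; rewrite mxE mul0r.
have [l l0 gl] : exists2 c : C, c != 0 & g = c *: val f.
  apply: proportional_lifts => //; apply: same_twistor_minors => // z.
  - exact: (f0 (Some z)).
  - exact: (g0 (Some z)).
  - exact: (fg (Some z)).
have fn0 : val f != 0 by apply: contra_neq gn0 => e; rewrite gl e scaler0.
have ll : l^* * l = 1.
  have := sigmaK odd_d (val f); rewrite -/g gl sigmaZ -/g gl scalerA => e.
  apply/eqP; rewrite -subr_eq0.
  have : (l^* * l - 1) *: val f == 0 by rewrite scalerBl scale1r e subrr.
  by rewrite scaler_eq0 (negbTE fn0) orbF.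
pose c := sqrtC l.
have cc : c * c = l by rewrite -expr2 sqrtCK.
have c0 : c != 0 by rewrite sqrtC_eq0.
have c1 : c^* * c = 1.
  have ge0 : 0 <= c^* * c by rewrite mulrC mul_conjC_ge0.
  have : (c^* * c) ^+ 2 = 1 by rewrite expr2 mulrACA -rmorphM cc.
  by move/eqP; rewrite sqrp_eq1// => /eqP.
have cf0 : c *: val f \in @nonzero C 4 d.+1.
  by apply/mem_set; rewrite /nonzero /= scaler_eq0 negb_or c0.
exists (exist (fun v => v \in @nonzero C 4 d.+1) _ cf0).
  split => /=.
  - rewrite sigmaZ -/g gl scalerA -cc mulrA c1 mul1r//.
  - rewrite /wronskian !hpolyZ !derivZ -!mul_polyC.
    have <- : c%:P ^+ 2 * wronskian (val f) = 0 by rewrite wf mulr0.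
    by rewrite /wronskian; ring.
  - by move=> x; rewrite hevalZ scaler_eq0 negb_or c0 /=; exact: f0.
  - by rewrite /row_free eqmx_scale.
apply/eqmodP => /=; apply/asboolP; exists c^-1; rewrite ?invr_eq0//=.
by rewrite scalerA mulVf// scale1r.
Qed.
End AnyDegree.
End AntipodalInvariance.

(** * Quaternionic similitudes *)

Section Similitudes.
Variable R : realType.
Local Notation C := (cplx R).

Section Matrices.
Variables al be ga de s : C.

(** The matrix of (p, q) |-> (u p + s q, - s p + v q), where the quaternion
    u = al + be j acts on polynomials by u p = al p + be sigma(p), likewise for
    v = ga + de j; rows 0 and 1 are p and its partner, rows 2 and 3 are q and its
    partner. *)
Definition qmx : 'M[C]_4 := \matrix_(i, j)
  (nth [::] [:: [:: al; be; s; 0]; [:: - be^*; al^*; 0; s];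
                [:: - s; 0; ga; de]; [:: 0; - s; - de^*; ga^*]] i)`_j.

(** The two quaternionic rows (u, s) and (-s, v) have the same norm and are
    orthogonal either if s = 0 and u, v have the same norm, or if s is real and v is
    the conjugate of u. *)
Definition similitude : Prop := al * al^* + be * be^* + s ^+ 2 != 0 /\
  (s = 0 /\ al * al^* + be * be^* = ga * ga^* + de * de^* \/
   [/\ ga = al^*, de = - be & s^* = s]).

Lemma qmxE : (qmx 0 0 = al) * (qmx 0 1 = be) * (qmx 0 2 = s) * (qmx 0 3 = 0) *
  (qmx 1 0 = - be^*) * (qmx 1 1 = al^*) * (qmx 1 2 = 0) * (qmx 1 3 = s) *
  (qmx 2 0 = -s) * (qmx 2 1 = 0) * (qmx 2 2 = ga) * (qmx 2 3 = de) *
  (qmx 3 0 = 0) * (qmx 3 1 = - s) * (qmx 3 2 = - de^*) * (qmx 3 3 = ga^*).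
Proof. by rewrite !mxE. Qed.

Hypothesis qs : similitude.

Let mu := al * al^* + be * be^* + s ^+ 2.

Let adj : 'M[C]_4 := \matrix_(i, j) (qmx j i)^*.

Lemma qmx_adj : qmx *m adj = mu%:M.
Proof.
have [_ H] := qs.
apply/matrixP => i j; rewrite mxE [RHS]mxE sum4 ![adj _ _]mxE.
move: i j; case: H => [[s0 n]|[gE dE sE]]; apply: ord4P; apply: ord4P.
all: rewrite !qmxE /mu /= ?mulr1n ?mulr0n ?conjN ?conjK ?conj0.
1-16: rewrite s0 ?conj0; first [ring | rewrite n; ring].
all: rewrite ?gE ?dE ?sE ?conjN ?conjK; ring.
Qed.

Lemma qmx_unit : qmx \in unitmx.
Proof.
have [mu0 _] := qs.
have := @mulmx1_unit _ _ qmx (mu^-1 *: adj).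
by rewrite -scalemxAr qmx_adj scale_scalar_mx mulVf// => /(_ erefl)[].
Qed.

Lemma jmap_qmx (v : 'rV[C]_4) : jmap (v *m qmx^T) = jmap v *m qmx^T.
Proof.
have [_ H] := qs.
have sE : s^* = s by case: H => [[-> _]|[]//]; rewrite conj0.
apply/rowP; apply: ord4P; rewrite jE [RHS]mxE mxE ?sum4 ![qmx^T _ _]mxE ?qmxE ?jE.
all: rewrite ?(rmorphD, rmorphM) /= ?conjN ?conjK ?conj0 ?sE; ring.
Qed.

Section Action.
Variable d : nat.
Implicit Types f : 'M[C]_(4, d.+1).

Lemma sigma_qmx f : sigma (qmx *m f) = qmx *m sigma f.
Proof.
apply/matrixP => i j; rewrite mxE.
have -> : \row_k (qmx *m f) k (rev_ord j) = (\row_k f k (rev_ord j)) *m qmx^T.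
  by apply/rowP => k; rewrite !mxE; apply: eq_bigr => l _; rewrite !mxE mulrC.
rewrite jmap_qmx mxE [RHS]mxE mulr_sumr; apply: eq_bigr => k _.
by rewrite [qmx^T _ _]mxE [sigma f k j]mxE; ring.
Qed.

Lemma hpoly_mul (A : 'M[C]_4) f i : hpoly (A *m f) i = \sum_k (A i k) *: hpoly f k.
Proof.
apply/polyP => j; have [jd|jd] := ltnP j d.+1; last first.
  rewrite nth_default; last exact: leq_trans (size_hpoly _ _) jd.
  rewrite coef_sum big1// => k _; rewrite coefZ nth_default ?mulr0//.
  exact: leq_trans (size_hpoly _ _) jd.
rewrite -[j]/(val (Ordinal jd)) coef_hpoly mxE coef_sum.
by apply: eq_bigr => k _; rewrite coefZ coef_hpoly.
Qed.

(** The Wronskian is the sum of a quaternionic Hermitian form at p and at q, and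
    the matrix is unitary up to scale. *)
Lemma wronskian_qmx f : wronskian (qmx *m f) = mu%:P * wronskian f.
Proof.
have [_ H] := qs.
rewrite /wronskian !hpoly_mul !sum4 !qmxE !derivD !derivZ !scale0r -!mul_polyC.
case: H => [[s0 n]|[gE dE sE]]; last first.
  by rewrite /mu gE dE !conjN !conjK !(rmorphD, rmorphM, rmorphN) /=; ring.
rewrite /mu s0 expr2 mul0r addr0.
transitivity ((al * al^* + be * be^*)%:P * (
  (hpoly f 0)^`() * hpoly f 1 - hpoly f 0 * (hpoly f 1)^`()) +
  (ga * ga^* + de * de^*)%:P * (
  (hpoly f 2)^`() * hpoly f 3 - hpoly f 2 * (hpoly f 3)^`())).
  by rewrite !(rmorphD, rmorphM, rmorphN) /=; ring.
by rewrite -n; ring.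
Qed.

Lemma heval_mul (A : 'M[C]_4) f x : heval (A *m f) x = heval f x *m A^T.
Proof.
have H (g : 'M[C]_(4, d.+1)) z : hlift (A *m g) z = hlift g z *m A^T.
  apply/rowP => i; rewrite [LHS]mxE (hpoly_mul A g) horner_sum [RHS]mxE; apply: eq_bigr => k _.
  by rewrite hornerZ !mxE mulrC.
case: x => [z|] /=; first exact: H.
rewrite -H; congr hlift; apply/matrixP => i j; rewrite !mxE.
by apply: eq_bigr => k _; rewrite !mxE.
Qed.

Lemma good_qmx f : good f -> good (qmx *m f).
Proof.
move=> [sf wf f0 ff]; have qu := qmx_unit; split.
- by rewrite sigma_qmx sf.
- by rewrite wronskian_qmx wf mulr0.
- move=> x; rewrite heval_mul; apply: contra_neq (f0 x) => e.
  have qTu : qmx^T \in unitmx by rewrite unitmx_tr.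
  by rewrite -[heval f x](mulmxK qTu) e mul0mx.
- by rewrite /row_free eqmxMfull ?row_full_unit.
Qed.
End Action.
End Matrices.

Lemma continuous_qmx (T : topologicalType) (al be ga de s : T -> C) :
  continuous al -> continuous be -> continuous ga -> continuous de -> continuous s ->
  continuous (fun t => qmx (al t) (be t) (ga t) (de t) (s t)).
Proof.
move=> ca cb cg cd cs; apply: continuous_mx.
apply: ord4P; apply: ord4P; under eq_fun do rewrite qmxE.
- exact: ca.
- exact: cb.
- exact: cs.
- exact: cts_cst.
- by apply: cts_opp; exact: (cts_conj cb).
- exact: (cts_conj ca).
- exact: cts_cst.
- exact: cs.
- exact: (cts_opp cs).
- exact: cts_cst.
- exact: cg.
- exact: cd.
- exact: cts_cst.
- exact: (cts_opp cs).
- by apply: cts_opp; exact: (cts_conj cd).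
- exact: (cts_conj cg).
Qed.

Lemma continuous_mulmx (T : topologicalType) m n p (A : T -> 'M[C]_(m, n)) (f : 'M[C]_(n, p)) :
  continuous A -> continuous (fun t => A t *m f).
Proof.
move=> cA; apply: continuous_mx => i j; under eq_fun do rewrite mxE.
by apply: cts_sum => k; apply: cts_mul; [exact: cts_entry|exact: cts_cst].
Qed.

Lemma joined_qmx d (f : 'M[C]_(4, d.+1)) (al be ga de s : R -> C) : good f ->
  continuous al -> continuous be -> continuous ga -> continuous de -> continuous s ->
  qmx (al 0) (be 0) (ga 0) (de 0) (s 0) = 1%:M ->
  (forall t, 0 <= t <= 1 -> similitude (al t) (be t) (ga t) (de t) (s t)) ->
  joined (@good R d) f (qmx (al 1) (be 1) (ga 1) (de 1) (s 1) *m f).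
Proof.
move=> gf ca cb cg cd cs q0 qs.
pose F t := qmx (al t) (be t) (ga t) (de t) (s t) *m f.
have f0 : F 0 = f by rewrite /F q0 mul1mx.
have cF : continuous F by exact: (continuous_mulmx (continuous_qmx ca cb cg cd cs)).
have gF t : 0 <= t <= 1 -> good (F t) by move=> t01; apply: good_qmx gf; exact: qs.
by have := joined_path cF gF; rewrite f0.
Qed.
End Similitudes.

(** * Straightening the first two coefficients *)

Section Reduction.
Variable R : realType.
Local Notation C := (cplx R).

Definition qnorm (al be : C) : R := Num.sqrt (sqmod al + sqmod be).

Lemma qnormE al be : al * al^* + be * be^* = (qnorm al be)%:C%C * (qnorm al be)%:C%C.
Proof.
rewrite !mul_conj_sqmod -of_realD -of_realM -expr2 sqr_sqrtr//.
by rewrite addr_ge0 ?sqmod_ge0.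
Qed.

Lemma qnorm_eq0 al be : (qnorm al be == 0) = (al == 0) && (be == 0).
Proof.
rewrite sqrtr_eq0 -!sqmod_eq0.
have := sqmod_ge0 al; have := sqmod_ge0 be; move: (sqmod al) (sqmod be) => x y y0 x0.
rewrite le_eqVlt ltNge addr_ge0// orbF paddr_eq0//.
Qed.

Lemma cts_qnorm (T : topologicalType) (al be : T -> C) :
  continuous al -> continuous be -> continuous (fun t => qnorm (al t) (be t)).
Proof.
move=> ca cb; apply: (cts_comp (@sqrt_continuous R)).
exact: (cts_add (cts_sqmod ca) (cts_sqmod cb)).
Qed.

(** The segment from 1 to al + be j meets 0 only if be = 0 and al is real and
    negative. The term with k bends it off the real axis, on the side where al
    lies, so that the imaginary parts cannot cancel. *)
Lemma quaternion_path (al be : C) : (al != 0) || (be != 0) ->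
  exists (a b : R -> C), [/\ continuous a, continuous b,
   [/\ a 0 = 1, b 0 = 0, a 1 = al & b 1 = be] &
   forall t, 0 <= t <= 1 -> qnorm (a t) (b t) != 0].
Proof.
move=> ab0; pose k : R := if 0 <= cim al then 1 else -1.
exists (fun t => (1 - t)%:C%C + t%:C%C * al + 'i * (k * t * (1 - t))%:C%C).
exists (fun t => t%:C%C * be).
have c1 : continuous (fun t : R => 1 - t : R).
  by apply: cts_add; [exact: cts_cst|apply: cts_opp; exact: cts_id].
split.
- apply: cts_add; [apply: cts_add; [exact: cts_of_real|]|].
    by apply: cts_mul; [exact: continuous_of_real|exact: cts_cst].
  apply: cts_mul; first exact: cts_cst.
  apply: cts_of_real; apply: (cts_mul _ c1).
  by apply: cts_mul; [exact: cts_cst|exact: cts_id].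
- by apply: cts_mul; [exact: continuous_of_real|exact: cts_cst].
- by split; rewrite ?subrr ?subr0 ?(mulr0, mul0r, mulr1, mul1r, addr0, add0r).
move=> t /andP[t0 t1]; rewrite qnorm_eq0; apply/negP => /andP[/eqP ea /eqP eb].
have i1 : cre ('i : C) = 0 /\ cim ('i : C) = 1 by [].
have er := congr1 (@cre R) ea; have ei := congr1 (@cim R) ea.
have [r0 i0] : cre (0 : C) = 0 /\ cim (0 : C) = 0 by [].
rewrite !cplxE ?i1.1 ?i1.2 ?r0 ?i0 in er; rewrite !cplxE ?i1.1 ?i1.2 ?r0 ?i0 in ei.
have [t00|tn0] := eqVneq t 0; first by rewrite t00 in er; lra.
have be0 : be = 0.
  by move/eqP: eb; rewrite mulf_eq0 of_real_eq0 (negbTE tn0) => /eqP.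
have [t11|tn1] := eqVneq t 1.
  move: ea ab0; rewrite t11 subrr mulr0 mulr0 add0r addr0 mul1r => ->.
  by rewrite be0 eqxx.
have tt : 0 < t * (1 - t) by rewrite mulr_gt0 ?subr_gt0 ?lt_neqAle ?tn1// eq_sym tn0.
have tp : 0 < t by rewrite lt_neqAle eq_sym tn0.
move: ei; rewrite /k; case: leP => h ei.
  have : 0 <= t * cim al by rewrite mulr_ge0.
  by lra.
have : t * cim al < 0 by rewrite pmulr_rlt0.
by lra.
Qed.

Section AnyDegree.
Variable d : nat.
Implicit Types f g : 'M[C]_(4, d.+1).
Local Notation good := (@good R d).

Lemma qmx1 : qmx 1 0 1 0 0 = 1%:M :> 'M[C]_4.
Proof.
apply/matrixP; apply: ord4P; apply: ord4P; rewrite qmxE [RHS]mxE ?rmorph1 ?rmorph0 ?oppr0//.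
Qed.

Lemma qnorm10 : qnorm 1 0 = 1.
Proof.
rewrite /qnorm !sqmodE (_ : cre 1 = 1)// (_ : cim 1 = 0)// (_ : cre 0 = 0)//.
by rewrite (_ : cim 0 = 0)// expr1n expr0n !addr0 sqrtr1.
Qed.

(** The other block is multiplied by the norm of the quaternion, which keeps the
    matrix a similitude. *)
Lemma joined_rotate_left f al be : good f -> (al != 0) || (be != 0) ->
  joined good f (qmx al be (qnorm al be)%:C%C 0 0 *m f).
Proof.
move=> gf /quaternion_path[a [b [ca cb [a0 b0 <- <-] n0]]].
apply: (@joined_qmx R d f a b (fun t => (qnorm (a t) (b t))%:C%C)
   (fun=> 0) (fun=> 0) gf ca cb).
- exact: (cts_of_real (cts_qnorm ca cb)).
- exact: cts_cst.
- exact: cts_cst.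
- by rewrite a0 b0 qnorm10 qmx1.
move=> t t01; have := n0 t t01; split.
  by rewrite qnormE expr2 mul0r addr0 mulf_neq0 ?of_real_eq0.
by left; split => //; rewrite qnormE conj_of_real mul0r addr0.
Qed.

Lemma joined_rotate_right f ga de : good f -> (ga != 0) || (de != 0) ->
  joined good f (qmx (qnorm ga de)%:C%C 0 ga de 0 *m f).
Proof.
move=> gf /quaternion_path[a [b [ca cb [a0 b0 <- <-] n0]]].
have cn : continuous (fun t => (qnorm (a t) (b t))%:C%C : C).
  exact: (cts_of_real (cts_qnorm ca cb)).
apply: (@joined_qmx R d f (fun t => (qnorm (a t) (b t))%:C%C) (fun=> 0)
   a b (fun=> 0) gf cn _ ca cb).
- exact: cts_cst.
- exact: cts_cst.
- by rewrite a0 b0 qnorm10 qmx1.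
move=> t t01; have := n0 t t01; split.
  by rewrite conj_of_real mul0r expr2 mul0r !addr0 mulf_neq0 ?of_real_eq0.
by left; split => //; rewrite [RHS]qnormE conj_of_real mul0r addr0.
Qed.

Lemma coef_hpoly_qmx al be ga de s f k :
  ((hpoly (qmx al be ga de s *m f) 0)`_k =
     al * (hpoly f 0)`_k + be * (hpoly f 1)`_k + s * (hpoly f 2)`_k) *
  ((hpoly (qmx al be ga de s *m f) 1)`_k =
     - be^* * (hpoly f 0)`_k + al^* * (hpoly f 1)`_k + s * (hpoly f 3)`_k) *
  ((hpoly (qmx al be ga de s *m f) 2)`_k =
     - s * (hpoly f 0)`_k + ga * (hpoly f 2)`_k + de * (hpoly f 3)`_k) *
  ((hpoly (qmx al be ga de s *m f) 3)`_k =
     - s * (hpoly f 1)`_k - de^* * (hpoly f 2)`_k + ga^* * (hpoly f 3)`_k).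
Proof.
do ![split]; rewrite hpoly_mul sum4 !coefD !coefZ !qmxE; ring.
Qed.

(** With x and x' the quaternions formed by the constant terms of p and of q, the
    choice s = |x'|^2, v = x conj(x'), u = conj(v) gives - s x + v x' = 0. The segment
    from the identity stays among similitudes, because s > 0 after the start. *)
Lemma joined_q0 f : good f -> exists g, [/\ joined good f g,
  (hpoly g 2)`_0 = 0 & (hpoly g 3)`_0 = 0].
Proof.
move=> gf; set v := fun i => (hpoly f i)`_0.
have [e|] := eqVneq (qnorm (v 2) (v 3)) 0.
  move/eqP: e; rewrite qnorm_eq0 => /andP[/eqP e2 /eqP e3].
  exists f; split => //; exists (fun=> f); split => //; exact: cts_cst.
move=> n0; pose s1 := v 2 * (v 2)^* + v 3 * (v 3)^*.
have s10 : s1 != 0 by rewrite /s1 qnormE mulf_neq0 ?of_real_eq0.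
have s1J : s1^* = s1 by rewrite /s1 qnormE rmorphM/= !conj_of_real.
pose ga1 := v 0 * (v 2)^* + (v 1)^* * v 3.
pose de1 := v 0 * (v 3)^* - (v 1)^* * v 2.
pose ga (t : R) : C := (1 - t)%:C%C + t%:C%C * ga1.
pose de (t : R) : C := t%:C%C * de1.
pose s (t : R) : C := t%:C%C * s1.
have cg : continuous ga.
  apply: cts_add; last by apply: cts_mul; [exact: continuous_of_real|exact: cts_cst].
  by apply: cts_of_real; apply: cts_add; [exact: cts_cst|apply: cts_opp; exact: cts_id].
have cd : continuous de by apply: cts_mul; [exact: continuous_of_real|exact: cts_cst].
have cs : continuous s by apply: cts_mul; [exact: continuous_of_real|exact: cts_cst].
have j := @joined_qmx R d f (fun t => (ga t)^*) (fun t => - de t) ga de s gf.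
exists (qmx (ga 1)^* (- de 1) (ga 1) (de 1) (s 1) *m f); split.
- apply: (j (cts_conj cg) (cts_opp cd) cg cd cs).
  + by rewrite /ga /de /s !mul0r addr0 subr0 oppr0 rmorph1 qmx1.
  + move=> t t01; split; last first.
      by right; split; rewrite ?opprK ?conjK// /s conjM conj_of_real s1J.
    have sJ : s t * (s t)^* = s t ^+ 2.
      by rewrite /s conjM conj_of_real s1J expr2.
    rewrite -sJ !mul_conj_sqmod -!of_realD of_real_eq0 gt_eqF//.
    have [A B D] := And3 (sqmod_ge0 (ga t)^*) (sqmod_ge0 (- de t)) (sqmod_ge0 (s t)).
    have [t00|tn0] := eqVneq t 0.
      have : sqmod (ga t)^* != 0.
        by rewrite sqmod_eq0 /ga t00 mul0r addr0 subr0 rmorph1 oner_neq0.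
      by rewrite neq_lt ltNge A /= => P; lra.
    have : sqmod (s t) != 0 by rewrite sqmod_eq0 mulf_neq0 ?of_real_eq0.
    by rewrite neq_lt ltNge D /= => P; lra.
- rewrite coef_hpoly_qmx /s /ga /de -/(v 0) -/(v 2) -/(v 3) /s1 /ga1 /de1 subrr.
  by rewrite rmorph0 rmorph1; ring.
- rewrite coef_hpoly_qmx /s /ga /de -/(v 1) -/(v 2) -/(v 3) /s1 /ga1 /de1 subrr.
  by rewrite !(conjM, conjD, conjN, conjK) !rmorph0 !rmorph1; ring.
Qed.

(** Multiplication of p by the inverse of the quaternion of its constant term, which
    is nonzero because the lift does not vanish at 0. *)
Lemma joined_p0 f : good f -> (hpoly f 2)`_0 = 0 -> (hpoly f 3)`_0 = 0 ->
  exists g, [/\ joined good f g, (hpoly g 0)`_0 = 1, (hpoly g 1)`_0 = 0,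
    (hpoly g 2)`_0 = 0 & (hpoly g 3)`_0 = 0].
Proof.
move=> gf e2 e3; set v0 := (hpoly f 0)`_0; set v1 := (hpoly f 1)`_0.
have n0 : v0 * v0^* + v1 * v1^* != 0.
  rewrite qnormE mulf_eq0 orbb of_real_eq0 qnorm_eq0; apply/negP => /andP[/eqP z0 /eqP z1].
  have [_ _ f0 _] := gf; have /eqP := f0 (Some 0); apply; apply/rowP.
  by apply: ord4P; rewrite /= mxE horner_coef0 [RHS]mxE.
pose n := v0 * v0^* + v1 * v1^*.
have nJ : n^* = n by rewrite /n qnormE conjM !conj_of_real.
have vJ : (n^-1)^* = n^-1 by rewrite -[in RHS]nJ; exact: fmorphV.
pose al := v0^* / n; pose be := v1^* / n.
have ab0 : (al != 0) || (be != 0).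
  rewrite -negb_and; apply: contra_neqN n0 => /andP[].
  rewrite !mulf_eq0 invr_eq0 -/n => a b; apply/eqP; apply: contraT => n0.
  move: a b; rewrite (negbTE n0) !orbF !conjC_eq0 => /eqP a /eqP b.
  by rewrite /n a b !mul0r addr0 eqxx in n0.
exists (qmx al be (qnorm al be)%:C%C 0 0 *m f); split.
- exact: joined_rotate_left.
- rewrite coef_hpoly_qmx -/v0 -/v1 mul0r addr0 /al /be.
  by rewrite /n; field.
- rewrite coef_hpoly_qmx -/v0 -/v1 mul0r addr0 /al /be !conjM vJ !conjK; ring.
- by rewrite coef_hpoly_qmx e2 e3; ring.
- by rewrite coef_hpoly_qmx e2 e3; ring.
Qed.

(** The quaternion is the conjugate of that of the coefficients of z, divided by its
    norm; being a unit, it leaves p as it is. *)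
Lemma joined_q1 f : good f ->
  ((hpoly f 2)`_1 != 0) || ((hpoly f 3)`_1 != 0) -> exists g, [/\ joined good f g,
    forall k, (hpoly g 0)`_k = (hpoly f 0)`_k,
    forall k, (hpoly f 2)`_k = 0 -> (hpoly f 3)`_k = 0 ->
      (hpoly g 2)`_k = 0 /\ (hpoly g 3)`_k = 0,
    exists2 y : R, 0 < y & (hpoly g 2)`_1 = y%:C%C & (hpoly g 3)`_1 = 0].
Proof.
move=> gf; set v2 := (hpoly f 2)`_1; set v3 := (hpoly f 3)`_1 => v23.
pose N := qnorm v2 v3; pose n : C := N%:C%C.
have N0 : N != 0 by rewrite qnorm_eq0 negb_and.
have n0 : n != 0 by rewrite of_real_eq0.
have nJ : n^* = n by exact: conj_of_real.
have vJ : (n^-1)^* = n^-1 by rewrite -[in RHS]nJ; exact: fmorphV.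
pose ga := v2^* / n; pose de := v3^* / n.
have e1 : ga * ga^* + de * de^* = 1.
  rewrite /ga /de !conjM vJ !conjK.
  transitivity ((v2 * v2^* + v3 * v3^*) / (n * n)); first by field.
  by rewrite qnormE -/N -/n mulfV ?mulf_neq0.
have q1 : qnorm ga de = 1.
  have : (qnorm ga de) ^+ 2 == 1.
    by rewrite -(inj_eq (@complexI R)) rmorphXn/= expr2 -qnormE e1.
  by rewrite sqrp_eq1 ?sqrtr_ge0// => /eqP.
have gd0 : (ga != 0) || (de != 0).
  by rewrite -negb_and -qnorm_eq0 q1 oner_neq0.
exists (qmx (qnorm ga de)%:C%C 0 ga de 0 *m f); split.
- exact: joined_rotate_right.
- by move=> k; rewrite coef_hpoly_qmx q1 rmorph1; ring.
- by move=> k a b; rewrite !coef_hpoly_qmx a b; split; ring.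
- exists N; first by rewrite lt_def N0 sqrtr_ge0.
  rewrite coef_hpoly_qmx -/v2 -/v3 oppr0 mul0r add0r /ga /de.
  apply: (mulfI n0); rewrite -[RHS](qnormE v2 v3); field; exact: n0.
- rewrite coef_hpoly_qmx -/v2 -/v3 oppr0 mul0r add0r /ga /de !conjM vJ !conjK; ring.
Qed.
End AnyDegree.
End Reduction.

(** * Reduced curves *)

Section NormalForm.
Variable R : realType.
Local Notation C := (cplx R).
Local Notation good := (@good R 5).

(** The lift (p, sigma p, q, sigma q) with p = 1 + a z + b z^2 and
    q = y z + w1 z^2 + w2 z^3. *)
Definition reduced (a b y w1 w2 : C) : 'M[C]_(4, 6) := \matrix_(i, j)
  (nth [::] [:: [:: 1; a; b; 0; 0; 0]; [:: 0; 0; 0; b^*; - a^*; 1];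
                [:: 0; y; w1; w2; 0; 0]; [:: 0; 0; - w2^*; w1^*; - y^*; 0]] i)`_j.

Lemma hpolyE d (f : 'M[C]_(4, d.+1)) i : hpoly f i = \sum_(j < d.+1) f i j *: 'X^j.
Proof.
by rewrite /hpoly /rVpoly poly_def; apply: eq_bigr => j _; rewrite valK mxE.
Qed.

Lemma hpoly_reduced a b y w1 w2 :
  (hpoly (reduced a b y w1 w2) 0 = 1 + a%:P * 'X + b%:P * 'X^2) *
  (hpoly (reduced a b y w1 w2) 1 = (b^*)%:P * 'X^3 - (a^*)%:P * 'X^4 + 'X^5) *
  (hpoly (reduced a b y w1 w2) 2 = y%:P * 'X + w1%:P * 'X^2 + w2%:P * 'X^3) *
  (hpoly (reduced a b y w1 w2) 3 = (- w2^*)%:P * 'X^2 + (w1^*)%:P * 'X^3 - (y^*)%:P * 'X^4).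
Proof.
do ![split]; rewrite hpolyE !big_ord_recl big_ord0 !mxE /= -!mul_polyC ?polyCN ?polyC0 ?polyC1; ring.
Qed.

(** The coefficients of z^5 and z^6 are minus and plus the conjugates of those of
    z^3 and z^2: the Wronskian is compatible with sigma. *)
Lemma wronskian_reduced a b y w1 w2 : wronskian (reduced a b y w1 w2) =
  (y * w2^* - 3 * b^*)%:P * 'X^2 + (4 * a^* - 2 * (a * b^*) - 2 * (y * w1^*))%:P * 'X^3 +
  (3 * (a * a^*) + 3 * (y * y^*) - 5 - b * b^* - w1 * w1^* - w2 * w2^*)%:P * 'X^4 +
  (2 * (a^* * b) + 2 * (w1 * y^*) - 4 * a)%:P * 'X^5 + (w2 * y^* - 3 * b)%:P * 'X^6.
Proof.
rewrite /wronskian !hpoly_reduced !(derivD, derivN, derivM, derivC, derivX, derivXn).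
rewrite /=; ring.
Qed.

Lemma wronskian_reduced_eq0 a b y w1 w2 : wronskian (reduced a b y w1 w2) = 0 ->
  [/\ y * w2^* = 3 * b^*, y * w1^* = 2 * a^* - a * b^* &
  3 * (a * a^*) + 3 * (y * y^*) = 5 + b * b^* + w1 * w1^* + w2 * w2^*].
Proof.
rewrite wronskian_reduced => E.
have H n := congr1 (fun p : {poly C} => p`_n) E.
have := H 2%N; rewrite !coefD !coefCM !coefXn coef0 /= ?mulr1 ?mulr0 ?addr0 ?add0r => e2.
have := H 3%N; rewrite !coefD !coefCM !coefXn coef0 /= ?mulr1 ?mulr0 ?addr0 ?add0r => e3.
have := H 4%N; rewrite !coefD !coefCM !coefXn coef0 /= ?mulr1 ?mulr0 ?addr0 ?add0r => e4.
split; apply/eqP; rewrite -subr_eq0; apply/eqP => //.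
- apply: (mulfI (_ : (-2 : C) != 0)); first by rewrite oppr_eq0 pnatr_eq0.
  by rewrite mulr0 -[RHS]e3; ring.
- by rewrite -[RHS]e4; ring.
Qed.

Lemma sigma_reduced a b y w1 w2 : sigma (reduced a b y w1 w2) = reduced a b y w1 w2.
Proof.
have c1 : (1 : C)^* = 1 by exact: rmorph1.
apply/matrixP => i j; rewrite mxE; move: i j; apply: ord4P => j; rewrite jE mxE.
all: case: j => -[|[|[|[|[|[|//]]]]]] j6; rewrite !mxE /= ?conjN ?conjK ?conj0 ?c1; ring.
Qed.

Lemma row_free_reduced a b y w1 w2 : y != 0 -> row_free (reduced a b y w1 w2).
Proof.
move=> y0; apply: inj_row_free => v vf.
have E (k : nat) (k6 : (k < 6)%N) : \sum_i v 0 i * reduced a b y w1 w2 i (Ordinal k6) = 0.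
  by have := congr1 (fun u : 'rV[C]_6 => u 0 (Ordinal k6)) vf; rewrite !mxE.
have := E 0%N isT; rewrite sum4 !mxE /= !mulr0 !addr0 mulr1 => v0.
have := E 5%N isT; rewrite sum4 !mxE /= !mulr0 !addr0 add0r mulr1 => v1.
have := E 1%N isT; rewrite sum4 !mxE /= v0 !mulr0 !mul0r !addr0 !add0r => /eqP.
rewrite mulf_eq0 (negbTE y0) orbF => /eqP v2.
have := E 4%N isT; rewrite sum4 !mxE /= v1 !mulr0 !mul0r !addr0 !add0r => /eqP.
rewrite mulf_eq0 oppr_eq0 conjC_eq0 (negbTE y0) orbF => /eqP v3.
by apply/rowP; apply: ord4P; rewrite [RHS]mxE.
Qed.

(** The excluded values form a Moebius band in C^2: b = - u^2 and a = t u with u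
    on the unit circle and t real. *)
Definition regular (a b : C) : Prop := ~ (b * b^* = 1 /\ a + a^* * b = 0).

(** A common zero z of the first two components is not 0, and eliminating between
    the first equation and the conjugate of the second gives a z = |z|^2 - 1 and
    b z = - conj(z). These force |b| = 1 and a + conj(a) b = 0. *)
Lemma heval_reduced a b y w1 w2 x : regular a b -> heval (reduced a b y w1 w2) x != 0.
Proof.
move=> reg; apply/eqP => e.
have ei i : heval (reduced a b y w1 w2) x 0 i = 0 by rewrite e mxE.
case: x {e} ei => [z|] ei; last first.
  have := ei 1; rewrite /= hlift_flip0 hpoly_reduced.
  rewrite !(coefD, coefN, coefCM, coefXn) /= !mulr0 oppr0 !add0r => /eqP.
  by rewrite oner_eq0.
have := ei 0; have := ei 1; rewrite /= ![hlift _ _ _ _]mxE !hpoly_reduced.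
rewrite !(hornerD, hornerN, hornerCM, hornerXn, hornerC, hornerX) => e1 e0.
have z0 : z != 0.
  apply/eqP => z0; move: e0; rewrite z0 expr0n /= !mulr0 !addr0 => /eqP.
  by rewrite oner_eq0.
have {}e1 : b^* - a^* * z + z ^+ 2 = 0.
  apply: (mulfI (expf_neq0 3 z0)); rewrite mulr0 -[RHS]e1; ring.
have eb : b - a * z^* + z^* ^+ 2 = 0.
  have := congr1 (fun u : C => u^*) e1; rewrite /= !(conjD, conjN, conjM) !conjK.
  by rewrite (_ : 0^* = 0 :> C) ?expr2//; exact: rmorph0.
pose r := z * z^*.
have r0 : 1 + r != 0.
  by rewrite gt_eqF// ltr_pwDl ?ltr01// /r mul_conjC_ge0.
have rJ : r^* = r by rewrite /r conjM conjK mulrC.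
have ea : a * z = r - 1.
  apply: (mulfI r0); apply/eqP; rewrite -subr_eq0; apply/eqP.
  transitivity ((1 + a * z + b * z ^+ 2) - (b - a * z^* + z^* ^+ 2) * z ^+ 2).
    by rewrite /r; ring.
  by rewrite e0 eb mul0r subrr.
have ebz : b * z = - z^*.
  apply/eqP; rewrite -subr_eq0; apply/eqP.
  have -> : b * z - - z^* = (b - a * z^* + z^* ^+ 2) * z + z^* * (a * z - (r - 1)).
    by rewrite /r; ring.
  by rewrite eb ea subrr mulr0 mul0r addr0.
have zJ0 : z^* != 0 by rewrite conjC_eq0.
apply: reg; split.
  apply: (mulIf (mulf_neq0 z0 zJ0)).
  transitivity ((b * z) * (b * z)^*); first by rewrite conjM; ring.
  by rewrite ebz conjN conjK; ring.
apply: (mulIf z0); rewrite mul0r mulrDl -mulrA ebz ea mulrN -conjM ea.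
by rewrite conjD conjN rJ rmorph1 subrr.
Qed.

(** For such a and b the Wronskian equations force y^2 = 3. Then the four
    components are p, conj(b) z^3 p, y z p and - y conj(b) z^2 p, so each root of p
    is a common zero. *)
Lemma singular_root a b w1 w2 (y : R) : y != 0 ->
  wronskian (reduced a b y%:C%C w1 w2) = 0 -> b * b^* = 1 -> a + a^* * b = 0 ->
  exists z, heval (reduced a b y%:C%C w1 w2) (Some z) = 0.
Proof.
move=> y0 /wronskian_reduced_eq0[e2 e1 en] bb ab.
have b0 : b != 0.
  by apply/eqP => b0; move: bb; rewrite b0 mul0r => /esym/eqP; rewrite oner_eq0.
set yc := y%:C%C in e2 e1 en *.
have yc0 : yc != 0 by rewrite of_real_eq0.
have yJ : yc^* = yc by exact: conj_of_real.
have c3 : (3 : C)^* = 3 by exact: conj_nat.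
have vJ : (yc^-1)^* = yc^-1 by rewrite -[in RHS]yJ; exact: fmorphV.
have abJ : a * b^* = - a^*.
  transitivity (- (a^* * (b * b^*))); last by rewrite bb mulr1.
  by apply/eqP; rewrite -subr_eq0; apply/eqP; rewrite -[RHS](mul0r b^*) -ab; ring.
have w1E : w1 = 3 * a / yc.
  rewrite -[w1]conjK; have -> : w1^* = 3 * a^* / yc.
    by apply: (mulfI yc0); rewrite e1 abJ; field.
  by rewrite !conjM vJ c3 conjK.
have w2E : w2 = 3 * b / yc.
  rewrite -[w2]conjK; have -> : w2^* = 3 * b^* / yc.
    by apply: (mulfI yc0); rewrite e2; field.
  by rewrite !conjM vJ c3 conjK.
(* the other root of the quadratic equation for y^2 is negative *)
have yy : yc * yc = 3.
  have : (yc * yc - 3) * (yc * yc + a * a^* + 1) = 0.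
    apply: (mulfI (_ : (3 : C) != 0)); first by rewrite pnatr_eq0.
    transitivity ((yc * yc) * (3 * (a * a^*) + 3 * (yc * yc^*) -
       (5 + b * b^* + w1 * w1^* + w2 * w2^*))); last by rewrite en subrr !mulr0.
    rewrite w1E w2E !conjM vJ c3 yJ bb.
    have -> : 3 * b / yc * (3 * b^* / yc) = 9 * (b * b^*) / (yc * yc).
      by field.
    by rewrite bb; field.
  move/eqP; rewrite mulf_eq0 => /orP[/eqP|/eqP h].
    by move/eqP; rewrite subr_eq0 => /eqP.
  have : 0 < yc * yc + a * a^* + 1.
    rewrite ltr_wpDl ?ltr01// addr_ge0 ?mul_conjC_ge0//.
    by rewrite -{2}yJ mul_conjC_ge0.
  by rewrite h ltxx.
have [z] : exists z, root (hpoly (reduced a b yc w1 w2) 0) z.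
  apply/closed_rootP; apply/eqP => s1; move/negP: b0; apply; apply/eqP.
  have : (hpoly (reduced a b yc w1 w2) 0)`_2 = 0 by rewrite nth_default ?s1.
  rewrite hpoly_reduced !(coefD, coefCM, coefXn, coefC, coefX) /=.
  by rewrite !mulr0 mulr1 !add0r.
move=> /rootP rz; exists z; apply/rowP; apply: ord4P.
all: rewrite /= [RHS]mxE mxE.
  exact: rz.
all: move: rz; rewrite !hpoly_reduced.
all: rewrite !(hornerD, hornerN, hornerCM, hornerXn, hornerC, hornerX) => rz.
all: have rz' : b^* - a^* * z + z ^+ 2 = 0.
1,3,5: apply: (mulfI b0); rewrite mulr0.
1,2,3: transitivity (b * b^* - (a + a^* * b) * z + a * z + b * z ^+ 2);
  [ring|by rewrite bb ab mul0r subr0].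
- by transitivity (z ^+ 3 * (b^* - a^* * z + z ^+ 2)); [ring|rewrite rz' mulr0].
- transitivity (yc * z * (1 + a * z + b * z ^+ 2) + (3 - yc * yc) / yc * (a * z ^+ 2 + b * z ^+ 3)).
    by rewrite w1E w2E; field.
  by rewrite rz yy subrr mulr0 !mul0r addr0.
- rewrite w1E w2E yJ !conjM vJ c3.
  transitivity (- (3 / yc * z ^+ 2 * (b^* - a^* * z + z ^+ 2)) + (3 - yc * yc) / yc * z ^+ 4).
    by field.
  by rewrite rz' yy subrr mulr0 !mul0r oppr0 addr0.
Qed.
End NormalForm.

(** * The horizontal reduced curves *)

Section Model.
Variable R : realType.
Local Notation C := (cplx R).
Local Notation good := (@good R 5).

(** For a horizontal reduced curve the coefficients of z^2 and z^3 of the Wronskian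
    express w1 and w2 by a, b and y. Substituted into the coefficient of z^4, they
    leave the equation 3 Y^2 = model_lin Y + model_cst for Y = y^2, whose larger root
    is model_sq. As model_cst is nonnegative, this is the only positive root. *)
Definition model_lin (a b : C) : R := 5 - 3 * sqmod a + sqmod b.
Definition model_cst (a b : C) : R := sqmod (2 * a - a^* * b) + 9 * sqmod b.
Definition model_sq (a b : C) : R :=
  (model_lin a b + Num.sqrt (model_lin a b ^+ 2 + 12 * model_cst a b)) / 6.
Definition model_y (a b : C) : R := Num.sqrt (model_sq a b).
Definition model (a b : C) : 'M[C]_(4, 6) :=
  reduced a b (model_y a b)%:C%C ((2 * a - a^* * b) / (model_y a b)%:C%C)
    (3 * b / (model_y a b)%:C%C).

Lemma model_cst_ge0 a b : 0 <= model_cst a b.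
Proof. by rewrite addr_ge0 ?mulr_ge0 ?sqmod_ge0. Qed.

Lemma model_sq_root a b : 3 * model_sq a b ^+ 2 = model_lin a b * model_sq a b + model_cst a b.
Proof.
have N0 := model_cst_ge0 a b.
have D0 : 0 <= model_lin a b ^+ 2 + 12 * model_cst a b by rewrite addr_ge0 ?sqr_ge0// mulr_ge0.
rewrite /model_sq; set s := Num.sqrt _.
have ss : s ^+ 2 = model_lin a b ^+ 2 + 12 * model_cst a b by rewrite sqr_sqrtr.
have -> : model_cst a b = (s ^+ 2 - model_lin a b ^+ 2) / 12 by rewrite ss; field.
by field.
Qed.

(** The constant model_cst vanishes only at a = b = 0, and there model_lin is 5. *)
Lemma model_sq_gt0 a b : 0 < model_sq a b.
Proof.
have N0 := model_cst_ge0 a b; rewrite /model_sq divr_gt0//.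
have [B0|B0] := ltP 0 (model_lin a b).
  by rewrite ltr_pwDl ?sqrtr_ge0.
have Np : 0 < model_cst a b.
  rewrite lt_def N0 andbT; apply/eqP => e.
  have A := sqmod_ge0 (2 * a - a^* * b); have D := sqmod_ge0 b.
  have /eqP : sqmod b = 0 by move: e; rewrite /model_cst; lra.
  rewrite sqmod_eq0 => /eqP b0.
  have /eqP : sqmod (2 * a) = 0.
    by move: e; rewrite /model_cst b0 mulr0 subr0; have := sqmod_ge0 (0 : C); have := sqmod_ge0 (2 * a); lra.
  rewrite sqmod_eq0 mulf_eq0 pnatr_eq0 /= => /eqP a0.
  have z : sqmod (0 : C) = 0 by apply/eqP; rewrite sqmod_eq0.
  by move: B0; rewrite /model_lin a0 b0 z; lra.
rewrite -ltrBlDl sub0r -[- model_lin a b]ger0_norm ?oppr_ge0// normrN -sqrtr_sqr.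
by rewrite ltr_sqrt ?ltrDl ?mulr_gt0// ltr_wpDl ?sqr_ge0 ?mulr_gt0.
Qed.

Lemma model_sq_unique a b Y : 0 < Y ->
  3 * Y ^+ 2 = model_lin a b * Y + model_cst a b -> Y = model_sq a b.
Proof.
move=> Y0 e; have Z0 := model_sq_gt0 a b; have f := model_sq_root a b; have N0 := model_cst_ge0 a b.
move: (model_sq a b) (model_lin a b) (model_cst a b) Z0 f N0 e => Z B N Z0 f N0 e.
have : (Y - Z) * (3 * Y * Z + N) = 0.
  have -> : (Y - Z) * (3 * Y * Z + N) =
     Z * (3 * Y ^+ 2 - (B * Y + N)) - Y * (3 * Z ^+ 2 - (B * Z + N)) by ring.
  by rewrite e f !subrr !mulr0 subrr.
move/eqP; rewrite mulf_eq0 => /orP[|/eqP h]; first by rewrite subr_eq0 => /eqP.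
have : 0 < 3 * Y * Z + N by rewrite ltr_pwDl ?mulr_gt0.
by rewrite h ltxx.
Qed.

Lemma model_y_gt0 a b : 0 < model_y a b.
Proof. by rewrite sqrtr_gt0 model_sq_gt0. Qed.

Lemma reduced_norm_eq a b (y : R) (w1 w2 : C) : y != 0 ->
  w1 = (2 * a - a^* * b) / y%:C%C -> w2 = 3 * b / y%:C%C ->
  (3 * (a * a^*) + 3 * (y%:C%C * (y%:C%C)^*) = 5 + b * b^* + w1 * w1^* + w2 * w2^*) <->
  3 * (y ^+ 2) ^+ 2 = model_lin a b * y ^+ 2 + model_cst a b.
Proof.
move=> y0 -> ->.
have D (u : C) : (u / y%:C%C) * (u / y%:C%C)^* = (sqmod u / y ^+ 2)%:C%C.
  have e : (y%:C%C^-1 : C) = (y^-1)%:C%C by rewrite fmorphV.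
  rewrite conjM e conj_of_real mulrACA mul_conj_sqmod -!of_realM; congr (_%:C%C).
  by field.
have s3 : sqmod (3 * b) = 9 * sqmod b.
  have [r3 i3] : cre (3 : C) = 3 /\ cim (3 : C) = 0.
    have -> : (3 : C) = (3 : R)%:C%C by rewrite rmorph_nat.
    by [].
  by rewrite !sqmodE creM cimM r3 i3; ring.
have n3 : (3 : C) = (3 : R)%:C%C by rewrite rmorph_nat.
have n5 : (5 : C) = (5 : R)%:C%C by rewrite rmorph_nat.
rewrite !D conj_of_real !mul_conj_sqmod s3 n3 n5 -!of_realM -!of_realD.
rewrite /model_cst /model_lin; move: (sqmod a) (sqmod b) (sqmod (_ - _)) => A B M.
transitivity (3 * A + 3 * (y * y) = 5 + B + M / y ^+ 2 + 9 * B / y ^+ 2).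
  by split=> [/complexI|->].
split=> h.
  transitivity ((3 * A + 3 * (y * y) - 3 * A) * y ^+ 2); first by ring.
  by rewrite h; field.
apply: (mulIf (expf_neq0 2 y0)).
transitivity (3 * (y ^+ 2) ^+ 2 + 3 * A * y ^+ 2); first by ring.
by rewrite h; field.
Qed.

Lemma good_model a b : regular a b -> good (model a b).
Proof.
move=> reg; have y0 := lt0r_neq0 (model_y_gt0 a b).
have yc0 : ((model_y a b)%:C%C : C) != 0 by rewrite of_real_eq0.
split; [exact: sigma_reduced| |by move=> x; exact: heval_reduced|exact: row_free_reduced].
have e4 : 3 * (model_y a b ^+ 2) ^+ 2 = model_lin a b * model_y a b ^+ 2 + model_cst a b.
  by rewrite /model_y sqr_sqrtr ?ltW ?model_sq_gt0// model_sq_root.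
have {}e4 := (reduced_norm_eq y0 erefl erefl).2 e4.
rewrite /model wronskian_reduced; set y := (model_y a b)%:C%C in yc0 e4 *.
have yJ : y^* = y by exact: conj_of_real.
have vJ : (y^-1)^* = y^-1 by rewrite -[in RHS]yJ; exact: fmorphV.
have c3 : (3 : C)^* = 3 by exact: conj_nat.
have c2 : (2 : C)^* = 2 by exact: conj_nat.
set w1 := (2 * a - a^* * b) / y in e4 *; set w2 := 3 * b / y in e4 *.
have -> : 3 * (a * a^*) + 3 * (y * y^*) - 5 - b * b^* - w1 * w1^* - w2 * w2^* = 0.
  by rewrite e4; ring.
have -> : y * w2^* - 3 * b^* = 0 by rewrite /w2 !conjM vJ c3; field.
have -> : w2 * y^* - 3 * b = 0 by rewrite /w2 yJ; field.
have -> : 4 * a^* - 2 * (a * b^*) - 2 * (y * w1^*) = 0.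
  by rewrite /w1 conjM conjD conjN !conjM conjK vJ c2; field.
have -> : 2 * (a^* * b) + 2 * (w1 * y^*) - 4 * a = 0 by rewrite /w1 yJ; field.
by rewrite polyC0 !mul0r !addr0.
Qed.

Lemma wronskian_coef d (f : 'M[C]_(4, d.+1)) n : (wronskian f)`_n =
  \sum_(j < n.+1) ((hpoly f 0)`_j.+1 * (hpoly f 1)`_(n - j) *+ j.+1 -
     (hpoly f 0)`_j * (hpoly f 1)`_(n - j).+1 *+ (n - j).+1 +
     (hpoly f 2)`_j.+1 * (hpoly f 3)`_(n - j) *+ j.+1 -
     (hpoly f 2)`_j * (hpoly f 3)`_(n - j).+1 *+ (n - j).+1).
Proof.
rewrite /wronskian !(coefD, coefN) !coefM -!sumrN -!big_split /=.
apply: eq_bigr => j _; rewrite !coef_deriv; ring.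
Qed.

Lemma good_coefs (f : 'M[C]_(4, 6)) : sigma f = f ->
  forall k, (k < 6)%N ->
  (hpoly f 1)`_k = (-1) ^+ k.+1 * ((hpoly f 0)`_(5 - k))^* /\
  (hpoly f 3)`_k = (-1) ^+ k.+1 * ((hpoly f 2)`_(5 - k))^*.
Proof.
move=> sf k k6; pose j := Ordinal k6.
have e : (5 - k)%N = rev_ord j :> nat by rewrite /= subSS.
rewrite e -[k]/(val j) !coef_hpoly; split.
  by rewrite -[in LHS]sf mxE jE !mxE.
by rewrite -[in LHS]sf mxE jE !mxE.
Qed.

Lemma matrix_coefs (f g : 'M[C]_(4, 6)) :
  (forall i k, (k < 6)%N -> (hpoly f i)`_k = (hpoly g i)`_k) -> f = g.
Proof. by move=> H; apply/matrixP => i j; rewrite -!coef_hpoly; exact: H. Qed.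

Let natE := (addn0, add1n, subn0, subnn, subSS).

(** The coefficients of 1 and z of the Wronskian give the first two equations. If the
    coefficients of z in q and in its partner vanished, then those of z^2 and z^3 of
    the Wronskian would leave p = 1, and that of z^4 would be minus the sum of 5 and
    two squares. *)
Lemma q1_neq0 (f : 'M[C]_(4, 6)) : good f -> (hpoly f 0)`_0 = 1 -> (hpoly f 1)`_0 = 0 ->
  (hpoly f 2)`_0 = 0 -> (hpoly f 3)`_0 = 0 ->
  [/\ (hpoly f 1)`_1 = 0, (hpoly f 1)`_2 = 0 &
    ((hpoly f 2)`_1 != 0) || ((hpoly f 3)`_1 != 0)].
Proof.
move=> [sf wf _ _] p0 t0 q0 u0.
have W n : (wronskian f)`_n = 0 by rewrite wf coef0.
have rc := good_coefs sf.
have n0 (n : nat) (x : C) : x *+ n.+1 = 0 -> x = 0.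
  by move/eqP; rewrite mulrn_eq0 => /eqP.
have t1 : (hpoly f 1)`_1 = 0.
  have := W 0%N; rewrite wronskian_coef big_ord_recl big_ord0 /= ?natE p0 t0 q0 u0.
  move=> e; apply/eqP; rewrite -oppr_eq0; apply/eqP; rewrite -[RHS]e; ring.
have t2 : (hpoly f 1)`_2 = 0.
  have := W 1%N; rewrite wronskian_coef !big_ord_recl big_ord0 /= /bump /= ?natE p0 t0 t1 q0 u0.
  move=> e; apply: (n0 1%N); apply/eqP; rewrite -oppr_eq0; apply/eqP; rewrite -[RHS]e; ring.
split => //; rewrite -negb_and; apply/negP => /andP[/eqP q1 /eqP u1].
have t3 : (hpoly f 1)`_3 = 0.
  have := W 2%N; rewrite wronskian_coef !big_ord_recl big_ord0 /= /bump /= ?natE p0 t0 t1 t2 q0 u0 q1 u1.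
  move=> e; apply: (n0 2%N); apply/eqP; rewrite -oppr_eq0; apply/eqP; rewrite -[RHS]e; ring.
have t4 : (hpoly f 1)`_4 = 0.
  have := W 3%N; rewrite wronskian_coef !big_ord_recl big_ord0 /= /bump /= ?natE p0 t0 t1 t2 t3 q0 u0 q1 u1.
  move=> e; apply: (n0 3%N); apply/eqP; rewrite -oppr_eq0; apply/eqP; rewrite -[RHS]e; ring.
have t5 : (hpoly f 1)`_5 = 1.
  have [-> _] := rc 5%N isT; rewrite p0 rmorph1; ring.
have [_ u2] := rc 2%N isT; have [_ u3] := rc 3%N isT; have [_] := rc 4%N isT.
rewrite /= q1 conj0 mulr0 => u4.
have := W 4%N; rewrite wronskian_coef !big_ord_recl big_ord0 /= /bump /= ?natE p0 t0 t1 t2 t3 t4 t5 q0 u0 q1 u1 u2 u3 u4 => e.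
have : 0 < 5 + (hpoly f 2)`_2 * ((hpoly f 2)`_2)^* + (hpoly f 2)`_3 * ((hpoly f 2)`_3)^*.
  by rewrite !ltr_wpDr ?mul_conjC_ge0 ?ltr0n.
suff -> : 5 + (hpoly f 2)`_2 * ((hpoly f 2)`_2)^* + (hpoly f 2)`_3 * ((hpoly f 2)`_3)^* = 0.
  by rewrite ltxx.
apply/eqP; rewrite -oppr_eq0; apply/eqP; rewrite -[RHS]e; ring.
Qed.
End Model.

(** * Contracting to the model curve *)

Section Contraction.
Variable R : realType.
Local Notation C := (cplx R).
Local Notation good := (@good R 5).

Lemma good_reduced_model (f : 'M[C]_(4, 6)) (y : R) : good f ->
  (hpoly f 0)`_0 = 1 -> (hpoly f 1)`_0 = 0 -> (hpoly f 1)`_1 = 0 -> (hpoly f 1)`_2 = 0 ->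
  (hpoly f 2)`_0 = 0 -> (hpoly f 3)`_0 = 0 -> (hpoly f 2)`_1 = y%:C%C -> (hpoly f 3)`_1 = 0 ->
  0 < y -> exists a b, regular a b /\ f = model a b.
Proof.
move=> [sf wf f0 _] p0 t0 t1 t2 q0 u0 q1 u1 y0.
pose a := (hpoly f 0)`_1; pose b := (hpoly f 0)`_2.
pose w1 := (hpoly f 2)`_2; pose w2 := (hpoly f 2)`_3.
have rc := good_coefs sf.
have cz (s x : C) : s != 0 -> 0 = s * x^* -> x = 0.
  by move=> s0 /esym/eqP; rewrite mulf_eq0 (negbTE s0) conjC_eq0 => /eqP.
have sg n : (-1) ^+ n != 0 :> C by rewrite signr_eq0.
have [e50 v50] := rc 0%N isT; have [e41 v41] := rc 1%N isT.
have [e32 v32] := rc 2%N isT; have [e23 v23] := rc 3%N isT.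
have [e14 v14] := rc 4%N isT; have [e05 v05] := rc 5%N isT.
rewrite !(subn0, subSS) in e50 v50 e41 v41 e32 v32 e23 v23 e14 v14 e05 v05.
have p5 : (hpoly f 0)`_5 = 0 by rewrite t0 in e50; exact: cz (sg _) e50.
have p4 : (hpoly f 0)`_4 = 0 by rewrite t1 in e41; exact: cz (sg _) e41.
have p3 : (hpoly f 0)`_3 = 0 by rewrite t2 in e32; exact: cz (sg _) e32.
have q5 : (hpoly f 2)`_5 = 0 by rewrite u0 in v50; exact: cz (sg _) v50.
have q4 : (hpoly f 2)`_4 = 0 by rewrite u1 in v41; exact: cz (sg _) v41.
have fE : f = reduced a b y%:C%C w1 w2.
  apply: matrix_coefs; apply: ord4P => k k6; rewrite hpoly_reduced !(coefD, coefN, coefCM, coefXn, coefX, coef1);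
    case: k k6 => [|[|[|[|[|[|//]]]]]] _ /=;
    rewrite ?p0 ?t0 ?t1 ?t2 ?q0 ?u0 ?q1 ?u1 ?p5 ?p4 ?p3 ?q5 ?q4 ?e23 ?v32 ?v23 ?e14 ?e05 ?v14 ?v05;
    rewrite ?p0 ?q1 ?q0 ?conj0 ?conj_of_real ?rmorph1 -/a -/b -/w1 -/w2; ring.
have yn0 : y != 0 by rewrite gt_eqF.
have yc0 : (y%:C%C : C) != 0 by rewrite of_real_eq0.
have W := wf; rewrite fE in W.
have [h2 h1 h4] := wronskian_reduced_eq0 W.
have yJ : (y%:C%C : C)^* = y%:C%C by exact: conj_of_real.
have vJ : ((y%:C%C : C)^-1)^* = (y%:C%C)^-1 by rewrite -[in RHS]yJ; exact: fmorphV.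
have w1E : w1 = (2 * a - a^* * b) / y%:C%C.
  rewrite -[w1]conjK; have -> : w1^* = (2 * a^* - a * b^*) / y%:C%C.
    by rewrite -h1; field.
  by rewrite conjM vJ conjD conjN !conjM !conjK (_ : 2^* = 2 :> C)//; exact: rmorph_nat.
have w2E : w2 = 3 * b / y%:C%C.
  rewrite -[w2]conjK; have -> : w2^* = 3 * b^* / y%:C%C.
    by rewrite -h2; field.
  by rewrite !conjM vJ !conjK (_ : 3^* = 3 :> C)//; exact: rmorph_nat.
have yE : y = model_y a b.
  have /model_sq_unique Y : 3 * (y ^+ 2) ^+ 2 = model_lin a b * y ^+ 2 + model_cst a b.
    exact: (reduced_norm_eq yn0 w1E w2E).1 h4.
  by rewrite /model_y -Y ?exprn_gt0// sqrtr_sqr gtr0_norm.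
exists a, b; split.
  move=> [bb ab]; have [z] := singular_root yn0 W bb ab.
  by apply/eqP; rewrite -fE; exact: f0.
by rewrite {1}fE w1E w2E yE.
Qed.

Lemma joined_to_model (f : 'M[C]_(4, 6)) : good f ->
  exists a b, regular a b /\ joined good f (model a b).
Proof.
move=> gf; have [f1 [j1 q0 u0]] := joined_q0 gf.
have [f2 [j2 p0' t0' q0' u0']] := joined_p0 (joined_end j1) q0 u0.
have g2 := joined_end j2.
have [t1 t2 n0] := q1_neq0 g2 p0' t0' q0' u0'.
have [f3 [j3 pE zE [y y0 q1] u1]] := joined_q1 g2 n0.
have g3 := joined_end j3.
have rc := good_coefs (let: And4 sf _ _ _ := g3 in sf).
have rc2 := good_coefs (let: And4 sf _ _ _ := g2 in sf).
have tE k : (k < 6)%N -> (hpoly f3 1)`_k = (hpoly f2 1)`_k.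
  by move=> k6; rewrite (rc k k6).1 (rc2 k k6).1 pE.
have p0 : (hpoly f3 0)`_0 = 1 by rewrite pE.
have t0 : (hpoly f3 1)`_0 = 0 by rewrite tE.
have s1 : (hpoly f3 1)`_1 = 0 by rewrite tE.
have s2 : (hpoly f3 1)`_2 = 0 by rewrite tE.
have [r0 r1] := zE 0%N q0' u0'.
have [a [b [reg f3E]]] := good_reduced_model g3 p0 t0 s1 s2 r0 r1 q1 u1 y0.
exists a, b; split=> //; rewrite -f3E.
exact: joined_trans j1 (joined_trans j2 j3).
Qed.

Lemma continuous_reduced (a b y w1 w2 : R -> C) : continuous a -> continuous b ->
  continuous y -> continuous w1 -> continuous w2 ->
  continuous (fun t => reduced (a t) (b t) (y t) (w1 t) (w2 t)).
Proof.
move=> ca cb cy cw1 cw2.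
have k (c : C) : continuous (fun _ : R => c) by exact: cts_cst.
have cNJ (g : R -> C) : continuous g -> continuous (fun t => - (g t)^*).
  by move=> cg; apply: cts_opp; exact: (cts_conj cg).
apply: continuous_mx; apply: ord4P; apply: ord6P => j j6; under eq_fun do rewrite mxE.
- case: j j6 => [|[|[|[|[|[|j]]]]]] j6; last by exfalso; exact: (notF j6).
  + exact: (k 1).
  + exact: ca.
  + exact: cb.
  + exact: (k 0).
  + exact: (k 0).
  + exact: (k 0).
- case: j j6 => [|[|[|[|[|[|j]]]]]] j6; last by exfalso; exact: (notF j6).
  + exact: (k 0).
  + exact: (k 0).
  + exact: (k 0).
  + exact: (cts_conj cb).
  + exact: (cNJ a ca).
  + exact: (k 1).
- case: j j6 => [|[|[|[|[|[|j]]]]]] j6; last by exfalso; exact: (notF j6).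
  + exact: (k 0).
  + exact: cy.
  + exact: cw1.
  + exact: cw2.
  + exact: (k 0).
  + exact: (k 0).
- case: j j6 => [|[|[|[|[|[|j]]]]]] j6; last by exfalso; exact: (notF j6).
  + exact: (k 0).
  + exact: (k 0).
  + exact: (cNJ w2 cw2).
  + exact: (cts_conj cw1).
  + exact: (cNJ y cy).
  + exact: (k 0).
Qed.

Lemma continuous_model (a b : R -> C) : continuous a -> continuous b ->
  continuous (fun t => model (a t) (b t)).
Proof.
move=> ca cb.
have cw : continuous (fun t => 2 * a t - (a t)^* * b t).
  apply: cts_add; first by apply: cts_mul; [exact: cts_cst|exact: ca].
  by apply: cts_opp; apply: cts_mul; [exact: (cts_conj ca)|exact: cb].
have cB : continuous (fun t => model_lin (a t) (b t)).
  apply: cts_add; last exact: (cts_sqmod cb).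
  apply: cts_add; first exact: cts_cst.
  by apply: cts_opp; apply: cts_mul; [exact: cts_cst|exact: (cts_sqmod ca)].
have cN : continuous (fun t => model_cst (a t) (b t)).
  apply: cts_add; first exact: (cts_sqmod cw).
  by apply: cts_mul; [exact: cts_cst|exact: (cts_sqmod cb)].
have cY : continuous (fun t => model_sq (a t) (b t)).
  apply: cts_mul; last exact: cts_cst.
  apply: cts_add; first exact: cB.
  apply: (cts_comp (@sqrt_continuous R)).
  apply: cts_add; first exact: (cts_exp (n := 2) cB).
  by apply: cts_mul; [exact: cts_cst|exact: cN].
have cy : continuous (fun t => (model_y (a t) (b t))%:C%C : C).
  exact: (cts_of_real (cts_comp (@sqrt_continuous R) cY)).
have cyV : continuous (fun t => ((model_y (a t) (b t))%:C%C : C)^-1).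
  apply: (cts_inv _ cy) => t; rewrite of_real_eq0; exact: lt0r_neq0 (model_y_gt0 _ _).
have c1 := cts_mul cw cyV.
have c2 : continuous (fun t => 3 * b t / (model_y (a t) (b t))%:C%C).
  by apply: (cts_mul _ cyV); apply: cts_mul; [exact: cts_cst|exact: cb].
exact: (continuous_reduced ca cb cy c1 c2).
Qed.

Lemma joined_model (a b : R -> C) : continuous a -> continuous b ->
  (forall t, 0 <= t <= 1 -> regular (a t) (b t)) ->
  joined good (model (a 0) (b 0)) (model (a 1) (b 1)).
Proof.
move=> ca cb reg.
have gF t : 0 <= t <= 1 -> good (model (a t) (b t)) by move=> t01; exact/good_model/reg.
exact: (joined_path (continuous_model ca cb) gF).
Qed.

Lemma continuous_segment (u v : C) : continuous (fun t : R => u + t%:C%C * (v - u)).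
Proof.
apply: cts_add; first exact: cts_cst.
by apply: cts_mul; [exact: continuous_of_real|exact: cts_cst].
Qed.

Lemma joined_model_segment (a b a' b' : C) :
  (forall t : R, 0 <= t <= 1 ->
    regular (a + t%:C%C * (a' - a)) (b + t%:C%C * (b' - b))) ->
  joined good (model a b) (model a' b').
Proof.
move=> reg; have := joined_model (@continuous_segment a a') (@continuous_segment b b') reg.
by rewrite !mul0r !addr0 !mul1r !(addrC a) !(addrC b) !subrK.
Qed.

Lemma regular_norm (a b : C) : b * b^* != 1 -> regular a b.
Proof. by move=> /eqP b1 [/b1]. Qed.

(** Only b on the unit circle can be irregular, and shrinking b leaves the circle at
    once. *)
Lemma joined_shrink (a b : C) : regular a b -> b * b^* <= 1 ->
  joined good (model a b) (model 0 0).
Proof.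
move=> reg b1; apply: (@joined_trans _ _ _ _ (model a 0)); last first.
  apply: joined_model_segment => t _; apply: regular_norm.
  by rewrite subr0 mulr0 addr0 mul0r eq_sym oner_neq0.
apply: joined_model_segment => t /andP[t0 t1]; rewrite subrr mulr0 addr0 sub0r mulrN.
have [->|tn0] := eqVneq t 0; first by rewrite mul0r subr0.
have tp : 0 < t by rewrite lt_neqAle eq_sym tn0.
apply: regular_norm; rewrite lt_eqF//.
rewrite conjD conjN conjM conj_of_real.
have -> : (b - t%:C%C * b) * (b^* - t%:C%C * b^*) = ((1 - t) ^+ 2)%:C%C * (b * b^*).
  by rewrite rmorphXn rmorphB rmorph1 /=; ring.
rewrite mul_conj_sqmod -of_realM of_real_lt1.
have : sqmod b <= 1 by rewrite -of_real_le1 -mul_conj_sqmod.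
have := sqmod_ge0 b => p q.
have : (1 - t) ^+ 2 < 1 by nra.
have : 0 <= (1 - t) ^+ 2 by rewrite sqr_ge0.
by move: ((1 - t) ^+ 2) => w w0 w1; nra.
Qed.

(** If |b| > 1, a is first moved to a square root c of b / |b|, with b kept off the
    unit circle. Along the ray of b one has c + conj(c) b = (1 + |b|) c,
    so the circle is crossed at a regular point. *)
Lemma joined_model0 (a b : C) : regular a b -> joined good (model a b) (model 0 0).
Proof.
move=> reg; have [b1|b1] := leP (sqmod b) 1.
  by apply: joined_shrink => //; rewrite mul_conj_sqmod of_real_le1.
pose s := Num.sqrt (sqmod b); pose be := b / s%:C%C.
have s0 : 0 < s by rewrite sqrtr_gt0; lra.
have ss : s * s = sqmod b by rewrite -expr2 sqr_sqrtr ?sqmod_ge0.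
have sc0 : (s%:C%C : C) != 0 by rewrite of_real_eq0 gt_eqF.
have s1 : 1 < s by nra.
have bebe : be * be^* = 1.
  have e : ((s%:C%C)^-1 : C) = (s^-1)%:C%C by rewrite fmorphV.
  rewrite /be conjM e conj_of_real mulrACA mul_conj_sqmod -!of_realM -ss.
  by rewrite (_ : _ * _ = 1)//; field; rewrite gt_eqF.
pose c := sqrtC be.
have cc : c * c = be by rewrite -expr2 sqrtCK.
have c1 : c * c^* = 1.
  have ge0 : 0 <= c * c^* by rewrite mul_conjC_ge0.
  have : (c * c^*) ^+ 2 = 1 by rewrite expr2 mulrACA -rmorphM cc.
  by move/eqP; rewrite sqrp_eq1// => /eqP.
have c0 : c != 0.
  by apply: contra_eq_neq c1 => ->; rewrite mul0r eq_sym oner_neq0.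
apply: (@joined_trans _ _ _ _ (model c b)).
  apply: joined_model_segment => t _; apply: regular_norm.
  by rewrite subrr mulr0 addr0 mul_conj_sqmod gt_eqF// lt1_of_real.
apply: (@joined_trans _ _ _ _ (model c be)); last first.
  apply: joined_shrink; last by rewrite bebe.
  move=> [_]; rewrite -cc mulrA [c^* * c]mulrC c1 mul1r => /eqP.
  by rewrite -mulr2n mulrn_eq0 (negbTE c0).
apply: joined_model_segment => t /andP[t0 t1]; rewrite subrr mulr0 addr0.
have bE : b = s%:C%C * be by rewrite /be mulrC mulfVK.
move=> [_]; rewrite {1 2}bE.
have -> : c + c^* * (s%:C%C * be + t%:C%C * (be - s%:C%C * be)) =
   c + (c * c^*) * ((s + t * (1 - s))%:C%C * c).
  by rewrite -cc !(rmorphD, rmorphM, rmorphN, rmorph1) /=; ring.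
rewrite c1 mul1r -{1}[c]mul1r -mulrDl => /eqP; rewrite mulf_eq0 (negbTE c0) orbF.
have -> : (1 : C) = (1 : R)%:C%C by [].
rewrite -of_realD of_real_eq0 gt_eqF//.
by nra.
Qed.

Lemma good_joined f h : good f -> good h -> joined good f h.
Proof.
move=> /joined_to_model[a [b [ab jf]]] /joined_to_model[a' [b' [ab' jh]]].
have j1 := joined_trans jf (joined_model0 ab).
exact: joined_trans j1 (joined_sym (joined_trans jh (joined_model0 ab'))).
Qed.

Lemma good_exists : exists f, good f.
Proof.
exists (model 0 0); apply/good_model/regular_norm.
by rewrite mul0r eq_sym oner_neq0.
Qed.
End Contraction.

Theorem corollary6p4 (R : realType) :
  path_connected R (AHHol R 5) /\
  path_connected R (AHarm_plus R 5) /\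
  path_connected R (AHarm_minus R 5).
Proof.
have [] // := @path_connected_of_joined R 5 (@good R 5).
- by move=> f [_ _ f0 _]; exact/holomorphic_coordsP.
- exact: good_joined.
- exact: good_exists.
- move=> psi; split=> [H|[f gf ->]]; first exact: (@AHHol_good R 5 isT psi H).
  exact: (@good_AHHol R 5 isT f gf).
Qed.
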